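(* Let $N>1$ be an integer, let $(X,\mu)$ be a nonatomic probability space and let $\mathcal{T}$ be an $N$-homogeneous tree-like family on $X$. Let $p>1$, let $F,f>0$ be real numbers with $f^{p}\leq F$, and let $\kappa\in(0,1]$. Then $$\mathcal{D}_{p}^{\mathcal{T}}(F,f,\kappa)=\min\left\{\kappa u^{p}+\frac{N^{p}-1}{N^{p}-N}\left(F-u^{p-1}f\right): f\leq u\leq\min\left(\left(\tfrac{F}{f}\right)^{1/(p-1)},\tfrac{f}{\kappa}\right)\right\},$$ and, writing $c(N,p)=\frac{p-1}{p}\cdot\frac{N^{p}-1}{N^{p}-N}$, one has $c(N,p)<1$ and $$\mathcal{D}_{p}^{\mathcal{T}}(F,f,\kappa)=\begin{cases}\kappa f^{p}+\dfrac{N^{p}-1}{N^{p}-N}\left(F-f^{p}\right) & \text{if } c(N,p)\leq\kappa\leq1,\\[2mm] \dfrac{N^{p}-1}{N^{p}-N}\left(F-c(N,p)^{p-1}\dfrac{f^{p}}{p\,\kappa^{p-1}}\right) & \text{if } c(N,p)\left(\frac{f^{p}}{F}\right)^{1/(p-1)}\leq\kappa\leq c(N,p),\\[2mm] \kappa\left(\dfrac{F}{f}\right)^{p/(p-1)} & \text{if } 0<\kappa\leq c(N,p)\left(\frac{f^{p}}{F}\right)^{1/(p-1)}.\end{cases}$$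
   Context: Let $(X,\mu)$ be a nonatomic probability space and $N>1$ an integer. A set $\mathcal{T}$ of measurable subsets of $X$ is called an $N$-homogeneous tree-like family if: (i) $X\in\mathcal{T}$, and to every $I\in\mathcal{T}$ there corresponds a finite subset $\mathcal{C}(I)\subseteq\mathcal{T}$ containing $N$ elements, each of measure $N^{-1}\mu(I)$, which are pairwise disjoint subsets of $I$ with $I=\bigcup\mathcal{C}(I)$; (ii) $\mathcal{T}=\bigcup_{m\geq0}\mathcal{T}_{(m)}$, where $\mathcal{T}_{(0)}=\{X\}$ and $\mathcal{T}_{(m+1)}=\bigcup_{I\in\mathcal{T}_{(m)}}\mathcal{C}(I)$; (iii) $\mathcal{T}$ differentiates $L^{1}(X,\mu)$, i.e. for every $\psi\in L^1(X,\mu)$ and $\mu$-almost every $x$, the averages $\frac{1}{\mu(I)}\int_I\psi\,d\mu$ over $I\in\mathcal{T}_{(m)}$ with $x\in I$ converge to $\psi(x)$ as $m\to\infty$. The associated maximal operator is $M_{\mathcal{T}}\psi(x)=\sup\left\{\frac{1}{\mu(I)}\int_{I}|\psi|\,d\mu: x\in I\in\mathcal{T}\right\}$ for $\psi\in L^{1}(X,\mu)$. For $p>1$, positive $F,f$ with $f^{p}\leq F$, and $\kappa\in(0,1]$, define $$\mathcal{D}_{p}^{\mathcal{T}}(F,f,\kappa)=\inf\left\{\sup_{\mu(E)=\kappa}\int_{E}(M_{\mathcal{T}}\phi)^{p}\,d\mu:\ \phi\geq0\text{ measurable with }\int_{X}\phi\,d\mu=f,\ \int_{X}\phi^{p}\,d\mu=F\right\},$$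 where the inner supremum is over all measurable subsets $E$ of $X$ with $\mu(E)=\kappa$. *)

(* Defs.v *)
From HB Require Import structures.
From mathcomp Require Import all_boot all_order all_algebra.
From mathcomp Require Import all_classical all_reals all_analysis.

Set Implicit Arguments.
Unset Strict Implicit.
Unset Printing Implicit Defensive.

Import Order.TTheory GRing.Theory Num.Theory.
Import numFieldNormedType.Exports.

Local Open Scope classical_set_scope.
Local Open Scope ring_scope.

Definition nonatomic d (X : measurableType d) (R : realType)
    (mu : {measure set X -> \bar R}) : Prop :=
  forall A, measurable A -> (0 < mu A)%E ->
    exists B, [/\ measurable B, B `<=` A, (0 < mu B)%E & (mu B < mu A)%E].

Fixpoint tree_level (X : Type) (C : set X -> set (set X)) (m : nat) :
    set (set X) :=
  if m is m'.+1 then \bigcup_(I in tree_level C m') C I else [set setT].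

(* The elements of the [m]-th level that contain [x] are selected by an arbitrary
   sequence [I]; since every level partitions [X], there is exactly one such
   sequence for each [x]. *)
Definition differentiates_L1 d (X : measurableType d) (R : realType)
    (mu : {measure set X -> \bar R}) (L : nat -> set (set X)) : Prop :=
  forall psi : X -> R, mu.-integrable setT (EFin \o psi) ->
    {ae mu, forall x, forall I : nat -> set X,
      (forall m, L m (I m) /\ I m x) ->
      (fine (mu (I m)))^-1 * (\int[mu]_(y in I m) psi y) @[m --> \oo]
        --> psi x}.

Record homogeneous_tree_with d (X : measurableType d) (R : realType)
    (mu : {measure set X -> \bar R}) (N : nat)
    (T : set (set X)) (C : set X -> set (set X)) : Prop := {
  tree_measurable : T `<=` measurable ;
  tree_root : T setT ;
  tree_children : forall I, T I -> C I `<=` T ;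
  tree_card : forall I, T I -> (C I #= `I_N)%card ;
  tree_measure : forall I J, T I -> C I J ->
    mu J = ((N%:R^-1)%:E * mu I)%E ;
  tree_disjoint : forall I, T I -> trivIset (C I) id ;
  tree_cover : forall I, T I -> I = \bigcup_(J in C I) J ;
  tree_levels : T = \bigcup_m tree_level C m ;
  tree_differentiates : differentiates_L1 mu (tree_level C)
}.

Definition homogeneous_tree d (X : measurableType d) (R : realType)
    (mu : {measure set X -> \bar R}) (N : nat) (T : set (set X)) : Prop :=
  exists C : set X -> set (set X), homogeneous_tree_with mu N T C.

Definition maximal_op d (X : measurableType d) (R : realType)
    (mu : {measure set X -> \bar R}) (T : set (set X)) (psi : X -> R) (x : X) :
    \bar R :=
  ereal_sup [set ((fine (mu I))^-1%:E * \int[mu]_(y in I) `|psi y|%:E)%E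
            | I in [set I | T I /\ I x]].

Definition admissible d (X : measurableType d) (R : realType)
    (mu : {measure set X -> \bar R}) (p F f : R) : set (X -> R) :=
  [set phi : X -> R | [/\ measurable_fun setT phi,
                          forall x, 0 <= phi x,
                          (\int[mu]_x (phi x)%:E = f%:E)%E &
                          (\int[mu]_x (phi x `^ p)%:E = F%:E)%E]].

Definition lower_bellman d (X : measurableType d) (R : realType)
    (mu : {measure set X -> \bar R}) (T : set (set X)) (p F f kappa : R) :
    \bar R :=
  ereal_inf [set
    ereal_sup [set (\int[mu]_(x in E) (maximal_op mu T phi x `^ p))%E
              | E in [set E | measurable E /\ mu E = kappa%:E]]
  | phi in admissible mu p F f].

Definition is_minimum (disp : Order.disp_t) (S : porderType disp)
    (A : set S) (m : S) : Prop :=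
  A m /\ lbound A m.

Definition homogeneous_ratio (R : realType) (N : nat) (p : R) : R :=
  (N%:R `^ p - 1) / (N%:R `^ p - N%:R).

Definition critical_kappa (R : realType) (N : nat) (p : R) : R :=
  (p - 1) / p * homogeneous_ratio N p.

(* Main.v *)
Require Import Defs.
From HB Require Import structures.
From mathcomp Require Import all_boot all_order all_algebra.
From mathcomp Require Import all_classical all_reals all_analysis.
From mathcomp Require Import measurable_realfun.
From mathcomp Require Import ring lra zify.

Set Implicit Arguments.
Unset Strict Implicit.
Unset Printing Implicit Defensive.

Import Order.TTheory GRing.Theory Num.Theory.
Import numFieldNormedType.Exports.

Local Open Scope classical_set_scope.
Local Open Scope ring_scope.

(** The value is computed by two inequalities that meet. Write a for
    [homogeneous_ratio N p], M for the maximal function of phi and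
    h u = kappa u^p + a (F - u^(p-1) f) for [bellman_candidate].

    Lower bound. Follow the averages of phi down the tree, and let W_n be the
    maximum of a number u >= f and of the averages met up to level n. A new
    average y that exceeds the current maximum m satisfies m < y <= N m, because
    a child carries the fraction 1/N of the measure of its parent; and a is the
    constant for which m^p - a m^(p-1) y <= (1 - a) y^p on this range, with
    equality at both ends ([jump_powR]). Hence W^p - a W^(p-1) phi has an
    integral that does not decrease with the level ([running_max_potential]). In
    the limit, since M >= phi almost everywhere, the integral of max(u, M)^p is
    at least u^p + a (F - u^(p-1) f) ([maximal_op_lower_bound]). If E of measure
    kappa lies between [M > u] and [M >= u], then max(u, M) is M on E and u
    outside E, and this becomes: the integral of M^p over E is at least h u. Such
    a level u exists between f and f / kappa by the weak type inequality
    ([maximal_op_quantile]), and the set E is cut out with elements of the tree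
    ([exists_superlevel_set]). When u is larger than (F/f)^(1/(p-1)), the trivial
    bound kappa u^p is enough.

    Upper bound. Equality holds above if phi = M wherever phi > 0 and every jump
    is by the factor N. For a given u this is realized by a self-similar
    construction: concentrate phi on a union of tree elements of total measure
    f / u, with average u on each of them; in such an element leave phi = u
    outside a union of subelements of total relative measure delta, and in each of
    these subelements push the whole mass into one child, which becomes an element
    of the next generation, with average N u ([heavy], [extremal]). The number
    delta is determined by the integral of phi^p. The maximal function is at most
    u N^k outside generation k + 1 ([maximal_op_extremal_le]), and summing
    geometric series gives the integrals ([lower_bellman_le]). All the unions of
    tree elements of prescribed measure come from the greedy [tree_packing].

    So the Bellman function is the least value of h between f and the smaller of
    (F/f)^(1/(p-1)) and f / kappa. As a function of u^(p-1), h is convex with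
    minimum at u = c f / kappa, where c = [critical_kappa N p]
    ([bellman_candidate_unimodal]), so the minimum is attained at the point of the
    interval closest to c f / kappa; as c < 1 this point is never forced to
    f / kappa, which leaves the three cases. *)

(** * Inequalities for real powers *)

Section power_inequalities.
Context {R : realType}.
Implicit Types p u v w x y M : R.

(** Young's inequality for v and u^(p-1), with exponents p and p/(p-1). *)
Lemma young_powR p u v : 1 < p -> 0 <= u -> 0 <= v ->
  p * (v * u `^ (p - 1)) <= (p - 1) * u `^ p + v `^ p.
Proof.
move=> p1 u0 v0.
have p0 : 0 < p by apply: lt_trans p1.
have pm0 : 0 < p - 1 by rewrite subr_gt0.
have := @conjugate_powR R v (u `^ (p - 1)) p (p / (p - 1)) v0 (powR_ge0 _ _) p0
  (divr_gt0 p0 pm0).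
have -> : p^-1 + (p / (p - 1))^-1 = 1 by field; lra.
move=> /(_ erefl).
rewrite -powRrM (_ : (p - 1) * (p / (p - 1)) = p); last by field; lra.
move=> h; rewrite -(ler_pM2l p0) in h; apply: (le_trans h).
rewrite le_eqVlt; apply/orP; left; apply/eqP.
by field; lra.
Qed.

(** Convexity in the form used below: the graph lies above its tangent at v. *)
Lemma tangent_powR p x v : 1 < p -> 0 <= x -> 0 < v ->
  v `^ p + p * v `^ (p - 1) * (x - v) <= x `^ p.
Proof.
move=> p1 x0 v0.
have := @young_powR p v x p1 (ltW v0) x0.
have := @mulr_powRB1 R v p (ltW v0) (lt_trans ltr01 p1).
move: (v `^ p) (v `^ (p - 1)) (x `^ p) => A B D <-; nra.
Qed.

Lemma powR_gt1 q x : 0 < q -> 1 < x -> 1 < x `^ q.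
Proof.
move=> q0 x1; rewrite [ltLHS](_ : _ = 1 `^ q); last by rewrite powR1.
by rewrite gt0_ltr_powR ?nnegrE// (le_trans ler01)// ltW.
Qed.

Lemma powR_invK q x : 0 < q -> 0 <= x -> (x `^ q^-1) `^ q = x.
Proof. by move=> q0 x0; rewrite -powRrM mulVf ?gt_eqF// powRr1. Qed.

Lemma le_powR_inv q x y : 0 < q -> 0 <= x -> 0 <= y -> x `^ q <= y ->
  x <= y `^ q^-1.
Proof.
move=> q0 x0 y0 xy; rewrite [leLHS](_ : _ = (x `^ q) `^ q^-1); last first.
  by rewrite -powRrM divff ?gt_eqF// powRr1.
by rewrite ge0_ler_powR ?nnegrE ?powR_ge0// invr_ge0 ltW.
Qed.

(** Two tangents, at 1 and at the midpoint m of 1 and x, are composed; the slope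
    at m is strictly larger than at 1, whence the strict inequality. *)
Lemma bernoulli_powR p x : 1 < p -> 1 < x -> 1 + p * (x - 1) < x `^ p.
Proof.
move=> p1 x1; pose m := (x + 1) / 2.
have m1 : 1 < m by rewrite /m; lra.
have x0 : 0 <= x by lra.
have m0 : 0 < m by lra.
have hx := @tangent_powR p x m p1 x0 m0.
have hm := @tangent_powR p m 1 p1 (ltW m0) ltr01.
rewrite !powR1 in hm.
have hmp : 1 < m `^ (p - 1) by rewrite powR_gt1// subr_gt0.
have xm : 0 < x - m by rewrite /m; lra.
have := mulr_gt0 (_ : 0 < p * (m `^ (p - 1) - 1)) xm.
move=> /(_ _); have -> : 0 < p * (m `^ (p - 1) - 1) by apply: mulr_gt0; lra.
move=> /(_ isT); move: hx hm; move: (m `^ (p - 1)) (x `^ p) (m `^ p) => a b e.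
nra.
Qed.

Lemma powR_gt_base p x : 1 < p -> 1 < x -> x < x `^ p.
Proof. by move=> p1 x1; have := @bernoulli_powR p x p1 x1; nra. Qed.

(** The weights x - y and y - 1 cancel the slope of the tangent at y, evaluated
    at 1 and at x. *)
Lemma convex_powR_chord p x y : 1 < p -> 1 <= y <= x -> 1 < x ->
  (x - 1) * y `^ p <= (x - y) + (y - 1) * x `^ p.
Proof.
move=> p1 /andP[y1 yx] x1.
have y0 : 0 < y by lra.
have h1 := @tangent_powR p 1 y p1 ler01 y0.
have hx := @tangent_powR p x y p1 (ltW (lt_trans ltr01 x1)) y0.
rewrite powR1 in h1.
move: h1 hx; move: (y `^ p) (y `^ (p - 1)) (x `^ p) => a b e h1 hx.
have := ler_wpM2l (_ : 0 <= x - y) h1; rewrite subr_ge0 => /(_ yx) h1'.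
have := ler_wpM2l (_ : 0 <= y - 1) hx; rewrite subr_ge0 => /(_ y1) hx'.
nra.
Qed.

Lemma homogeneous_ratio_gt1 N p : (1 < N)%N -> 1 < p ->
  1 < homogeneous_ratio N p.
Proof.
move=> N1 p1; have N1R : 1 < N%:R :> R by rewrite ltr1n.
have := @powR_gt_base p N%:R p1 N1R.
rewrite /homogeneous_ratio; move: N1R.
move: (N%:R `^ p) (N%:R : R) => x y y1 yx.
by rewrite ltr_pdivlMr; lra.
Qed.

Lemma critical_kappa_gt0 N p : (1 < N)%N -> 1 < p -> 0 < critical_kappa N p.
Proof.
move=> N1 p1; have a1 := @homogeneous_ratio_gt1 N p N1 p1.
by apply: mulr_gt0; [apply: divr_gt0|]; lra.
Qed.

(** After clearing denominators this is the strict Bernoulli inequality for N. *)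
Lemma critical_kappa_lt1 N p : (1 < N)%N -> 1 < p -> critical_kappa N p < 1.
Proof.
move=> N1 p1; have N1R : 1 < N%:R :> R by rewrite ltr1n.
have h := @powR_gt_base p N%:R p1 N1R.
have hb := @bernoulli_powR p N%:R p1 N1R.
rewrite /critical_kappa /homogeneous_ratio mulf_div ltr_pdivrMr; last by nra.
by move: h hb; move: (N%:R `^ p) => e; nra.
Qed.

(** With t = y / M and a the homogeneous ratio, this says that (a - 1) t^p - a t
    + 1 is at most 0. That function is convex and vanishes at t = 1 and, by the
    choice of a, at t = N. *)
Lemma jump_powR N p M y : (1 < N)%N -> 1 < p -> 0 < M -> M <= y <= N%:R * M ->
  M `^ p - homogeneous_ratio N p * (M `^ (p - 1) * y) <=
  (1 - homogeneous_ratio N p) * y `^ p.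
Proof.
move=> N1 p1 M0 /andP[My yNM]; set a := homogeneous_ratio N p.
have N1R : 1 < N%:R :> R by rewrite ltr1n.
have h := @powR_gt_base p N%:R p1 N1R.
have y0 : 0 <= y by lra.
pose t := y / M.
have yE : y = t * M by rewrite /t divfK// gt_eqF.
have t1 : 1 <= t by rewrite /t ler_pdivlMr// mul1r.
have tN : t <= N%:R by rewrite /t ler_pdivrMr.
have := @convex_powR_chord p N%:R t p1 _ N1R; rewrite t1 tN => /(_ isT) hc.
have -> : M `^ (p - 1) * y = t * M `^ p.
  rewrite yE -(@mulr_powRB1 R M p) 1?ltW//; last by lra.
  ring.
have -> : y `^ p = t `^ p * M `^ p.
  by rewrite yE powRM//; lra.
have Mp := powR_gt0 p M0.
suff : 1 - a * t <= (1 - a) * t `^ p by nra.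
have d0 : 0 < N%:R `^ p - N%:R by lra.
rewrite -(ler_pM2r d0).
have aE : a * (N%:R `^ p - N%:R) = N%:R `^ p - 1.
  by rewrite /a /homogeneous_ratio divfK// gt_eqF.
have -> : (1 - a * t) * (N%:R `^ p - N%:R) =
   (N%:R `^ p - N%:R) - t * (a * (N%:R `^ p - N%:R)) by ring.
have -> : (1 - a) * t `^ p * (N%:R `^ p - N%:R) =
   t `^ p * ((N%:R `^ p - N%:R) - (a * (N%:R `^ p - N%:R))) by ring.
rewrite aE; move: hc; lra.
Qed.

Definition bellman_candidate N p F f kappa u : R :=
  kappa * u `^ p + homogeneous_ratio N p * (F - u `^ (p - 1) * f).

(** As a function of t = u^(p-1) the candidate is, up to a positive factor and
    an affine term, the convex power t^(p/(p-1)), and w is the value of u at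
    which its derivative vanishes. Young's inequality is the supporting line at
    v, whose slope has the sign of v - w. So a single statement covers the
    minimum over any interval: v may be w, or the end of the interval that is
    closest to w. *)
Lemma bellman_candidate_unimodal N p F f kappa u v :
    (1 < N)%N -> 1 < p -> 0 < kappa -> 0 <= u -> 0 <= v ->
  let w := critical_kappa N p * f / kappa in
  0 <= (v - w) * (u - v) ->
  bellman_candidate N p F f kappa v <= bellman_candidate N p F f kappa u.
Proof.
move=> N1 p1 k0 u0 v0 w hw.
set a := homogeneous_ratio N p.
have pm0 : 0 < p - 1 by rewrite subr_gt0.
have kw : (p - 1) * (a * f) = p * (kappa * w).
  rewrite /w /critical_kappa -/a; field; lra.
rewrite /bellman_candidate -/a.
suff : p * (kappa * w) * (u `^ (p - 1) - v `^ (p - 1)) <=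
       (p - 1) * kappa * (u `^ p - v `^ p).
  rewrite -kw => hB; rewrite -(ler_pM2l pm0); move: hB.
  by move: (u `^ p) (v `^ p) (u `^ (p - 1)) (v `^ (p - 1)) => ? ? ? ?; nra.
have hy := @young_powR p u v p1 u0 v0.
have hv := @mulr_powRB1 R v p v0 (lt_trans ltr01 p1).
have hvw : 0 <= (v - w) * (u `^ (p - 1) - v `^ (p - 1)).
  have [uv|uv|->] := ltgtP u v; last by rewrite subrr mulr0.
  - have : u `^ (p - 1) <= v `^ (p - 1).
      by rewrite ge0_ler_powR ?nnegrE// ltW.
    have : v <= w by nra.
    move: (u `^ (p - 1)) (v `^ (p - 1)) => ? ? ? ?; nra.
  - have : v `^ (p - 1) <= u `^ (p - 1).
      by rewrite ge0_ler_powR ?nnegrE// ltW.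
    have : w <= v by nra.
    move: (u `^ (p - 1)) (v `^ (p - 1)) => ? ? ? ?; nra.
have p0 : 0 < p by lra.
have hk := mulr_ge0 (mulr_ge0 (ltW p0) (ltW k0)) hvw.
have : 0 <= kappa * ((p - 1) * u `^ p + v `^ p - p * (v * u `^ (p - 1))).
  by apply: mulr_ge0; lra.
move: hk hv; move: (u `^ p) (v `^ p) (u `^ (p - 1)) (v `^ (p - 1)).
by move=> A B D E hk <- ?; nra.
Qed.

End power_inequalities.

(** * Countable families of disjoint sets, and the combinatorics of the tree *)

Section countable_tilings.
Context d (X : measurableType d) (R : realType).
Implicit Types (G : set (set X)) (A B : set X).

(** Indices that are not used by the family get the empty set, so that countable
    additivity over the natural numbers applies. *)
Lemma countable_disjoint_enum G : countable G -> trivIset G id ->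
  exists E : nat -> set X, [/\ trivIset setT E,
    \bigcup_i E i = \bigcup_(J in G) J & forall i, G (E i) \/ E i = set0].
Proof.
move=> /countable_injP[g ginj] tG.
pose E i := \bigcup_(J in G `&` [set J | g J = i]) J.
have EP i J : G J -> g J = i -> E i = J.
  move=> GJ gJ; rewrite /E; apply/seteqP; split=> x.
    move=> [J' [GJ' gJ'] J'x]; suff -> : J = J' by [].
    by apply: ginj; rewrite ?inE// gJ gJ'.
  by move=> Jx; exists J.
exists E; split.
- apply/trivIsetP => i j _ _ ij; apply/seteqP; split=> // x [].
  move=> [J [GJ gJ] Jx] [J' [GJ' gJ'] J'x].
  have JJ' : J = J' by apply: (tG) => //; exists x.
  by move: ij; rewrite -gJ -gJ' JJ' eqxx.
- apply/seteqP; split=> x.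
    by move=> [i _ [J [GJ _] Jx]]; exists J.
  by move=> [J GJ Jx]; exists (g J) => //; exists J.
- move=> i; have [[J [GJ gJ]]|nJ] := pselect (exists J, G J /\ g J = i).
    by left; rewrite (EP i J).
  right; apply/seteqP; split=> // x [J [GJ gJ] _]; apply: nJ; by exists J.
Qed.

Lemma countable_union_measurable G : countable G -> G `<=` measurable ->
  measurable (\bigcup_(J in G) J).
Proof.
rewrite -(eq_countable (card_setT _)) => cG mG; rewrite bigcup_set_type.
by apply: countable_bigcupT_measurable => // J; apply: mG; exact: set_valP.
Qed.

(** Countable additivity in the form used below: a proportion between two
    measures is checked tile by tile. *)
Lemma measure_tiling_proportional (mu : {measure set X -> \bar R}) G A B (c : R) :
    countable G -> G `<=` measurable -> trivIset G id ->
    measurable A -> measurable B -> 0 <= c ->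
    (forall J, G J -> mu (A `&` J) = (c%:E * mu (B `&` J))%E) ->
  mu (A `&` \bigcup_(J in G) J) = (c%:E * mu (B `&` \bigcup_(J in G) J))%E.
Proof.
move=> cG mG tG mA mB c0 AB.
have [E [tE UE EG]] := @countable_disjoint_enum G cG tG.
have mE i : measurable (E i).
  by have [/mG//|->] := EG i; exact: measurable0.
rewrite -UE !setI_bigcupr !measure_bigcup//; first last.
- exact: trivIset_setIl.
- by move=> i _; exact: measurableI.
- exact: trivIset_setIl.
- by move=> i _; exact: measurableI.
rewrite -nneseriesZl//; apply: eq_eseriesr => i _.
have [/AB//|->] := EG i.
by rewrite !setI0 measure0 mule0.
Qed.

End countable_tilings.

(** The stopping rule of a greedy algorithm. *)
Lemma first_partial_sum_above {R : realDomainType} (m : nat -> R) (n : nat)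
    (r : R) :
    (0 < n)%N -> 0 <= r <= \sum_(0 <= i < n) m i ->
  exists2 k, (k < n)%N &
    \sum_(0 <= i < k) m i <= r <= \sum_(0 <= i < k.+1) m i.
Proof.
elim: n => // n IH _ /andP[r0 rn].
have [rS|Sr] := leP r (\sum_(0 <= i < n) m i); last first.
  by exists n => //; rewrite rn ltW.
case: n IH rn rS => [|n] IH rn rS.
  by exists 0%N => //; rewrite rn big_nil r0.
have [|k kn kP] := IH isT; first by rewrite r0.
by exists k => //; rewrite ltnS ltnW.
Qed.

Section tree.
Context {R : realType} {d : measure_display} {X : measurableType d}.
Context {mu : probability X R} {N : nat}.
Context {T : set (set X)} {C : set X -> set (set X)}.
Hypothesis N_gt1 : (1 < N)%N.
Hypothesis tree : homogeneous_tree_with mu N T C.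
Implicit Types (I J K : set X) (x : X).

Let N_gt0 : (0 < N)%N. Proof. exact: ltnW. Qed.
Let NR_gt1 : 1 < N%:R :> R. Proof. by rewrite ltr1n. Qed.
Let NR_gt0 : 0 < N%:R :> R. Proof. exact: lt_trans NR_gt1. Qed.

Local Notation level := (tree_level C).

Lemma children_enum : exists child : set X -> nat -> set X, forall I, T I ->
  set_bij `I_N (C I) (child I).
Proof.
have : forall I, exists c : nat -> set X, T I -> set_bij `I_N (C I) c.
  move=> I; have [TI|nTI] := pselect (T I); last by exists (fun _ => set0).
  have /card_esym/card_set_bijP[c cP] := tree_card tree TI.
  by exists c.
by move/choice => [c cP]; exists c.
Qed.

(** The children form an unordered set; an enumeration of them is chosen once
    and for all. *)
Definition child : set X -> nat -> set X := projT1 (cid children_enum).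

Lemma child_bij I : T I -> set_bij `I_N (C I) (child I).
Proof. exact: (projT2 (cid children_enum)). Qed.

Lemma childP I J : T I -> C I J -> exists2 i, (i < N)%N & J = child I i.
Proof.
by move=> /child_bij[_ _ s] CJ; have [i iN <-] := s _ CJ; exists i.
Qed.

Lemma child_in I i : T I -> (i < N)%N -> C I (child I i).
Proof. by move=> /child_bij[s _ _] iN; exact: s. Qed.

Lemma child_tree I i : T I -> (i < N)%N -> T (child I i).
Proof. by move=> TI iN; apply: (tree_children tree TI); exact: child_in. Qed.

Lemma child_disjoint I i j x : T I -> (i < N)%N -> (j < N)%N ->
  child I i x -> child I j x -> i = j.
Proof.
move=> TI iN jN ix jx; have [_ inj _] := child_bij TI.
apply: inj; rewrite ?inE//.
by apply: (tree_disjoint tree TI); [exact: child_in|exact: child_in|exists x].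
Qed.

Lemma child_cover I x : T I -> I x -> exists2 i, (i < N)%N & child I i x.
Proof.
move=> TI; rewrite {1}(tree_cover tree TI) => -[J CJ Jx].
by have [i iN JE] := childP TI CJ; exists i => //; rewrite -JE.
Qed.

Lemma child_sub I i : T I -> (i < N)%N -> child I i `<=` I.
Proof.
move=> TI iN x ix; rewrite (tree_cover tree TI).
by exists (child I i) => //; exact: child_in.
Qed.

Lemma tree_mu_child I i : T I -> (i < N)%N ->
  mu (child I i) = (N%:R^-1%:E * mu I)%E.
Proof. by move=> TI iN; apply: (tree_measure tree TI); exact: child_in. Qed.

Lemma child_bigcup I : T I -> I = \bigcup_(i in `I_N) child I i.
Proof.
move=> TI; apply/seteqP; split=> x.
  by move=> /(child_cover TI)[i iN ix]; exists i.
by move=> [i iN]; exact: child_sub.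
Qed.

Lemma trivIset_child I : T I -> trivIset `I_N (child I).
Proof.
by move=> TI i j iN jN [x [ix jx]]; exact: (@child_disjoint I i j x).
Qed.

Lemma level_tree m I : level m I -> T I.
Proof. by move=> mI; rewrite (tree_levels tree); exists m. Qed.

Lemma tree_level_ex I : T I -> exists m, level m I.
Proof. by rewrite {1}(tree_levels tree) => -[m _ mI]; exists m. Qed.

Lemma levelS m I i : level m I -> (i < N)%N -> level m.+1 (child I i).
Proof.
move=> mI iN; exists I => //; apply: child_in => //; exact: level_tree mI.
Qed.

Lemma levelSP m J : level m.+1 J ->
  exists I i, [/\ level m I, (i < N)%N & J = child I i].
Proof.
move=> [I mI CJ]; have [i iN ->] := childP (level_tree mI) CJ.
by exists I, i.
Qed.

Lemma mu_level m I : level m I -> mu I = (N%:R ^- m)%:E.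
Proof.
elim: m I => [|m IH] I; first by move=> ->; rewrite probability_setT expr0 invr1.
move=> /levelSP[K [i [mK iN ->]]].
by rewrite (tree_mu_child (level_tree mK) iN) (IH K mK) -EFinM exprS invfM.
Qed.

Lemma level_cover m x : exists2 I, level m I & I x.
Proof.
elim: m => [|m [I mI Ix]]; first by exists setT.
have [i iN ix] := child_cover (level_tree mI) Ix.
by exists (child I i) => //; exact: levelS.
Qed.

Lemma level_disjoint m I J x : level m I -> level m J -> I x -> J x -> I = J.
Proof.
elim: m I J => [|m IH] I J; first by move=> -> ->.
move=> /levelSP[I' [i [mI iN ->]]] /levelSP[J' [j [mJ jN ->]]] ix jx.
have TI := level_tree mI; have TJ := level_tree mJ.
have IJ : I' = J' by apply: IH => //; [exact: child_sub ix|exact: child_sub jx].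
by rewrite -IJ in jx *; rewrite (@child_disjoint I' i j x).
Qed.

Lemma level_nested m k I J x : level (m + k) I -> level m J -> I x -> J x ->
  I `<=` J.
Proof.
elim: k I => [|k IH] I; rewrite ?addn0 ?addnS.
  by move=> mI mJ Ix Jx; rewrite (level_disjoint mI mJ Ix Jx).
move=> /levelSP[I' [i [mI iN ->]]] mJ ix Jx.
have TI := level_tree mI.
by apply: subset_trans (child_sub TI iN) _; apply: IH => //; exact: child_sub ix.
Qed.

Lemma level_finite m : finite_set (level m).
Proof.
elim: m => [|m IH] /=; first exact: finite_set1.
apply: bigcup_finite => // I mI; exists N; exact: tree_card tree _ (level_tree mI).
Qed.

Lemma tree_countable : countable T.
Proof.
rewrite (tree_levels tree); apply: bigcup_countable => // m _.
by apply: finite_set_countable; exact: level_finite.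
Qed.

Lemma tree_mu_gt0 I : T I -> (0 < mu I)%E.
Proof.
move=> /tree_level_ex[m mI].
by rewrite (mu_level mI) lte_fin invr_gt0 exprn_gt0.
Qed.

Lemma cvg_invXn : (N%:R ^- n : R) @[n --> \oo] --> 0.
Proof.
have := @cvg_geometric R 1 N%:R^-1.
rewrite ger0_norm ?invr_ge0// invf_lt1// => /(_ NR_gt1).
by apply: cvg_trans; apply: near_eq_cvg; near=> n; rewrite /geometric/= mul1r exprVn.
Unshelve. all: by end_near. Qed.

End tree.

(** * Unions of tree elements of prescribed measure *)

Section packing.
Context {R : realType} {d : measure_display} {X : measurableType d}.
Context {mu : probability X R} {N : nat}.
Context {T : set (set X)} {C : set X -> set (set X)}.
Hypothesis N_gt1 : (1 < N)%N.
Hypothesis tree : homogeneous_tree_with mu N T C.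
Implicit Types (I J K : set X) (x : X).

Local Notation level := (tree_level C).
Local Notation child := (child tree).

(** A greedy choice along a branch. In K take as many of the first children as
    fit into the mass t, continue with the missing mass in the next child, and
    so on. The missing mass after n steps is at most the measure of an element n
    levels below K, hence tends to 0. With B = X this gives unions of tree
    elements of any measure, and for general B a subset of B of any measure. *)
Lemma tree_packing (B K : set X) (t : R) :
    measurable B -> T K -> 0 <= t -> (t%:E <= mu (B `&` K))%E ->
  exists G : set (set X), [/\ G `<=` T, trivIset G id,
    forall J, G J -> J `<=` K & mu (B `&` \bigcup_(J in G) J) = t%:E].
Proof.
move=> mB TK t0 tK.
have mT J : T J -> measurable J by move=> TJ; exact: (tree_measurable tree).
pose m (I : set X) i := fine (mu (B `&` child I i)).
have mE I i : T I -> (i < N)%N -> mu (B `&` child I i) = (m I i)%:E.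
  move=> TI iN; rewrite fineK// fin_num_measure//.
  by apply: measurableI => //; apply: mT; exact: child_tree.
have m0 I i : 0 <= m I i by rewrite fine_ge0.
have sumE I k : T I -> (k <= N)%N ->
    mu (B `&` \bigcup_(i in `I_k) child I i) = (\sum_(0 <= i < k) m I i)%:E.
  move=> TI kN.
  have ikN i : (i < k)%N -> (i < N)%N by move=> ik; exact: leq_trans kN.
  rewrite setI_bigcupr measure_fin_bigcup//.
  - rewrite -fsbig_ord big_mkord -sumEFin; apply: eq_bigr => i _.
    exact: mE (ikN _ (ltn_ord i)).
  - apply: trivIset_setIl => i j /ikN iN /ikN jN.
    exact: (trivIset_child TI iN jN).
  - by move=> i /= /ikN iN; apply: measurableI => //; apply: mT; exact: child_tree.
(* A state is the current element of the branch, with the mass that remains to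
   be taken inside it. *)
pose valid (z : set X * R) := T z.1 /\ 0 <= z.2 /\ (z.2%:E <= mu (B `&` z.1))%E.
have /choice[k kP] : forall z : set X * R, exists k : nat, valid z ->
    (k < N)%N /\ \sum_(0 <= i < k) m z.1 i <= z.2 <= \sum_(0 <= i < k.+1) m z.1 i.
  move=> z; have [vz|] := pselect (valid z); last by exists 0%N.
  have [|k kN kP] := @first_partial_sum_above _ (m z.1) N z.2 (ltnW N_gt1).
    have [Tz [-> /=]] := vz.
    by rewrite {1}(child_bigcup tree Tz) sumE// lee_fin.
  by exists k.
pose next z : set X * R := (child z.1 (k z), z.2 - \sum_(0 <= i < k z) m z.1 i).
have next_valid z : valid z -> valid (next z).
  move=> vz; have [kN /andP[kl kr]] := kP z vz; have [Tz _] := vz.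
  split; first exact: child_tree.
  rewrite subr_ge0 kl mE// lee_fin; split => //.
  by move: kr; rewrite big_nat_recr//= lerBlDl.
pose z n := iter n next (K, t).
have vz n : valid (z n) by elim: n => [|n IH] //=; exact: next_valid.
have Tz n : T (z n).1 by have [] := vz n.
have kN n : (k (z n) < N)%N by have [] := kP _ (vz n).
have z_dec n l : (z (n + l)%N).1 `<=` (z n).1.
  elim: l => [|l IH]; rewrite ?addn0// addnS.
  by apply: subset_trans IH; exact: child_sub.
have mu_z n : (mu (z n).1 <= (N%:R ^- n)%:E)%E.
  elim: n => [|n IH].
    by rewrite expr0 invr1; apply: probability_le1; exact: mT.
  rewrite /= (tree_mu_child tree (Tz n) (kN n)) exprS invfM EFinM.
  by rewrite lee_pmul2l// lte_fin invr_gt0 ltr0n ltnW.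
pose block n := \bigcup_(i in `I_(k (z n))) child (z n).1 i.
have mblock n : measurable (block n).
  apply: bigcup_measurable => i /= ik; apply: mT; apply: child_tree => //.
  exact: ltn_trans ik (kN n).
pose G := \bigcup_n [set child (z n).1 i | i in `I_(k (z n))].
have GE : \bigcup_(J in G) J = \bigcup_n block n.
  apply/seteqP; split=> x.
    by move=> [_ [n _ [i ik <-]] ix]; exists n => //; exists i.
  move=> [n _ [i ik ix]]; exists (child (z n).1 i) => //.
  by exists n => //; exists i.
(* The branch goes on in the child number [k (z n)], next to those taken. *)
have later n l i x : (i < k (z n))%N -> child (z n).1 i x -> ~ (z (n.+1 + l)%N).1 x.
  move=> ik ix /z_dec/= kx.
  have := child_disjoint (Tz n) (ltn_trans ik (kN n)) (kN n) ix kx.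
  by move=> iE; rewrite iE ltnn in ik.
have disj n n' i i' x : (i < k (z n))%N -> (i' < k (z n'))%N ->
    child (z n).1 i x -> child (z n').1 i' x -> n = n' /\ i = i'.
  wlog nn' : n n' i i' / (n <= n')%N.
    move=> W ik ik' ix ix'; have [nn'|/ltnW nn'] := leqP n n'; first exact: W.
    by have [-> ->] := W _ _ _ _ nn' ik' ik ix' ix.
  move=> ik ik' ix ix'; move: nn'; rewrite leq_eqVlt => /orP[/eqP nn'|nn'].
    split=> //; subst n'.
    apply: (child_disjoint (Tz n)) ix ix'; first exact: ltn_trans ik (kN n).
    exact: ltn_trans ik' (kN n).
  exfalso; apply: (later n (n' - n.+1)%N i x) => //; rewrite subnKC//.
  apply: child_sub ix' => //; exact: ltn_trans ik' (kN n').
exists G; split.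
- move=> _ [n _ [i /= ik <-]]; apply: child_tree => //.
  exact: ltn_trans ik (kN n).
- move=> _ _ [n _ [i /= ik <-]] [n' _ [i' /= ik' <-]] [x [ix ix']].
  by have [-> ->] := disj _ _ _ _ _ ik ik' ix ix'.
- move=> _ [n _ [i /= ik <-]].
  have := @z_dec 0 n; rewrite add0n; apply: subset_trans.
  by apply: child_sub => //; exact: ltn_trans ik (kN n).
rewrite GE setI_bigcupr measure_bigcup//; first last.
- move=> n n' _ _ [x [[_ [i /= ik ix]] [_ [i' /= ik' ix']]]].
  by have [] := disj _ _ _ _ _ ik ik' ix ix'.
- by move=> n _; exact: measurableI.
have blockE n : mu (B `&` block n) = ((z n).2 - (z n.+1).2)%:E.
  by rewrite sumE//; [rewrite /= opprB addrC subrK|exact: ltnW].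
rewrite (eq_eseriesr (fun n _ => blockE n)).
apply/cvg_lim => //.
rewrite (_ : (fun n => _) = EFin \o (fun n => t - (z n).2)); last first.
  apply/funext => n /=; rewrite sumEFin; congr EFin.
  under eq_bigl do rewrite in_setT.
  rewrite (@telescope_sumr_eq _ 0 n (fun k => - (z k).2))//=.
    by rewrite opprK addrC.
  by move=> i _; rewrite opprK addrC.
apply: cvg_EFin; first by near=> n.
rewrite -[X in _ --> X]subr0; apply: cvgB; first exact: cvg_cst.
apply: (@squeeze_cvgr _ _ _ _ (cst 0) (fun n => N%:R ^- n)).
- near=> n; have [_ [-> zn]] := vz n; rewrite -lee_fin.
  apply: (le_trans zn); apply: le_trans (mu_z n); apply: le_measure; rewrite ?inE.
  + by apply: measurableI => //; exact: mT.
  + exact: mT.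
  + exact: subIsetr.
- exact: cvg_cst.
- exact: cvg_invXn.
Unshelve. all: by end_near. Qed.

End packing.

(** * Averages over tree elements *)

Definition node (X : Type) (C : set X -> set (set X)) (m : nat) (x : X) : set X :=
  xget setT [set I | tree_level C m I /\ I x].

Definition avg d (X : measurableType d) (R : realType)
    (mu : {measure set X -> \bar R}) (phi : X -> R) (I : set X) : R :=
  (fine (mu I))^-1 * fine (\int[mu]_(x in I) (phi x)%:E).

Definition level_avg d (X : measurableType d) (R : realType)
    (mu : {measure set X -> \bar R}) (C : set X -> set (set X)) (phi : X -> R)
    (m : nat) (x : X) : R :=
  avg mu phi (node C m x).

(** The maximum is an accumulator: on an element J of level l + 1 the function
    unfolds to the one that starts from max(M, avg J), which is what an
    induction on n along the children needs. *)
Fixpoint running_max d (X : measurableType d) (R : realType)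
    (mu : {measure set X -> \bar R}) (C : set X -> set (set X)) (phi : X -> R)
    (l n : nat) (M : R) (x : X) : R :=
  if n is n'.+1 then
    running_max mu C phi l.+1 n' (Num.max M (level_avg mu C phi l.+1 x)) x
  else M.

Section averages.
Context {R : realType} {d : measure_display} {X : measurableType d}.
Context {mu : probability X R} {N : nat}.
Context {T : set (set X)} {C : set X -> set (set X)}.
Hypothesis N_gt1 : (1 < N)%N.
Hypothesis tree : homogeneous_tree_with mu N T C.
Implicit Types (I J K : set X) (x : X).

Local Notation level := (tree_level C).
Local Notation child := (child tree).
Local Notation node := (node C).

Let mT J : T J -> measurable J. Proof. exact: (tree_measurable tree). Qed.

Lemma nodeP m x : level m (node m x) /\ node m x x.
Proof.
apply: (@xgetPex _ setT [set I | level m I /\ I x]).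
by have [I mI Ix] := level_cover tree m x; exists I.
Qed.

Lemma node_eq m I x : level m I -> I x -> node m x = I.
Proof.
move=> mI Ix; have [mn nx] := nodeP m x.
exact: (level_disjoint tree mn mI nx Ix).
Qed.

Lemma ge0_integral_child I (g : X -> \bar R) : T I ->
    measurable_fun setT g -> (forall x, (0 <= g x)%E) ->
  (\int[mu]_(x in I) g x = \sum_(i < N) \int[mu]_(x in child I i) g x)%E.
Proof.
move=> TI mg g0.
have IE : I = \big[setU/set0]_(i < N) child I i.
  by rewrite {1}(child_bigcup tree TI) bigcup_mkord.
rewrite [in LHS]IE (@ge0_integral_bigsetU _ _ _ mu _ (fun i : 'I_N => child I i))//.
- by move=> i; apply: mT; exact: child_tree.
- exact: index_enum_uniq.
- move=> i j _ _ [x [ix jx]]; apply: val_inj.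
  exact: (child_disjoint TI _ _ ix jx).
- exact: measurable_funTS.
Qed.

Context {phi : X -> R} {f : R}.
Hypothesis mphi : measurable_fun setT phi.
Hypothesis phi0 : forall x, 0 <= phi x.
Hypothesis intphi : (\int[mu]_x (phi x)%:E = f%:E)%E.

Local Notation avg := (avg mu phi).
Local Notation level_avg := (level_avg mu C phi).
Local Notation running_max := (running_max mu C phi).

Let mphiE : measurable_fun setT (EFin \o phi).
Proof. exact/measurable_EFinP. Qed.

Lemma tree_integral_fin I : T I -> (\int[mu]_(x in I) (phi x)%:E)%E \is a fin_num.
Proof.
move=> TI; rewrite ge0_fin_numE; last first.
  by apply: integral_ge0 => x _; rewrite lee_fin.
apply: (@le_lt_trans _ _ f%:E); last exact: ltry.
rewrite -intphi; apply: ge0_subset_integral => //; first exact: mT.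
by move=> x _; rewrite lee_fin.
Qed.

Lemma tree_mu_fine I : T I -> 0 < fine (mu I).
Proof.
move=> TI; apply: fine_gt0; rewrite (tree_mu_gt0 N_gt1 tree TI) /=.
by rewrite ltey_eq fin_num_measure//; exact: mT.
Qed.

Lemma tree_integral_avg I : T I ->
  (\int[mu]_(x in I) (phi x)%:E = (avg I * fine (mu I))%:E)%E.
Proof.
move=> TI; rewrite /avg mulrAC mulVf ?mul1r ?fineK//; first exact: tree_integral_fin.
by rewrite gt_eqF// tree_mu_fine.
Qed.

Lemma avg_ge0 I : 0 <= avg I.
Proof.
rewrite mulr_ge0 ?invr_ge0 ?fine_ge0//.
by apply: integral_ge0 => x _; rewrite lee_fin.
Qed.

Lemma avg_child I i : T I -> (i < N)%N -> avg (child I i) <= N%:R * avg I.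
Proof.
move=> TI iN.
have Tc := child_tree tree TI iN.
rewrite -(ler_pM2r (tree_mu_fine Tc)) -lee_fin -tree_integral_avg//.
have -> : N%:R * avg I * fine (mu (child I i)) = avg I * fine (mu I).
  rewrite tree_mu_child// fineM//; last by rewrite fin_num_measure//; exact: mT.
  by rewrite mulrACA divff ?mul1r// gt_eqF// ltr0n ltnW.
rewrite -tree_integral_avg//; apply: ge0_subset_integral => //.
- exact: mT.
- exact: mT.
- exact: measurable_funTS.
- by move=> x _; rewrite lee_fin.
- exact: child_sub.
Qed.

Lemma measurable_level_avg m : measurable_fun setT (level_avg m).
Proof.
move=> _ Y mY; rewrite setTI.
rewrite (_ : _ @^-1` _ = \bigcup_(I in level m `&` [set I | Y (avg I)]) I).
  apply: countable_union_measurable.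
    apply: sub_countable (tree_countable tree).
    by apply: subset_card_le => I [/(level_tree tree)].
  by move=> I [/(level_tree tree)/mT].
apply/seteqP; split=> x.
  by move=> Yx; have [mn nx] := nodeP m x; exists (node m x).
by move=> [I [mI YI] Ix] /=; rewrite /level_avg (node_eq mI Ix).
Qed.

(** The supremum over all the elements containing x is countable: there is one
    element on each level. *)
Lemma maximal_opE x :
  maximal_op mu T phi x = ereal_sup (range (fun m => (level_avg m x)%:E)).
Proof.
rewrite /maximal_op; congr ereal_sup.
have avgE I : T I ->
    ((fine (mu I))^-1%:E * \int[mu]_(y in I) `|phi y|%:E)%E = (avg I)%:E.
  move=> TI; rewrite /avg EFinM fineK ?tree_integral_fin//.
  by congr (_ * _)%E; apply: eq_integral => y _; rewrite ger0_norm.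
apply/seteqP; split=> y.
  move=> [I /= [TI Ix] <-]; have [m mI] := tree_level_ex tree TI.
  by exists m => //; rewrite /level_avg (node_eq mI Ix) avgE.
move=> [m _ <-]; have [mn nx] := nodeP m x; have Tn := level_tree tree mn.
by exists (node m x) => //; exact: avgE.
Qed.

Lemma measurable_maximal_op : measurable_fun setT (maximal_op mu T phi).
Proof.
rewrite (_ : maximal_op mu T phi = fun x => esups (fun m => (level_avg m x)%:E) 0%N).
  apply: measurable_fun_esups => n; apply/measurable_EFinP.
  exact: measurable_level_avg.
apply/funext => x; rewrite maximal_opE /esups /= /sdrop; congr ereal_sup.
by apply/seteqP; split=> y [m _ <-]; exists m.
Qed.

Lemma avg_setT : avg setT = f.
Proof.
rewrite /avg (_ : _ setT = 1%E) ?intphi /= ?invr1 ?mul1r//.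
exact: probability_setT.
Qed.

Lemma maximal_op_ge_mean x : (f%:E <= maximal_op mu T phi x)%E.
Proof.
rewrite maximal_opE; apply: ereal_sup_ubound; exists 0%N => //.
by rewrite /level_avg (@node_eq 0%N setT) ?avg_setT.
Qed.

Lemma running_max_ge l n M x : M <= running_max l n M x.
Proof.
elim: n l M => [|n IH] l M //=.
by apply: le_trans (IH _ _); rewrite le_max lexx.
Qed.

Lemma level_avg_le_running_max l n M x :
  level_avg (l + n).+1 x <= running_max l n.+1 M x.
Proof.
elim: n l M => [|n IH] l M.
  by rewrite addn0 /= le_max lexx orbT.
by rewrite addnS -addSn; exact: IH.
Qed.

Lemma running_max_le_maximal_op l n M x :
  ((running_max l n M x)%:E <= maxe M%:E (maximal_op mu T phi x))%E.
Proof.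
elim: n l M => [|n IH] l M /=; first by rewrite le_max lexx.
apply: (le_trans (IH _ _)); rewrite ge_max; apply/andP; split; last first.
  by rewrite le_max lexx orbT.
rewrite EFin_max ge_max le_max lexx/= le_max; apply/orP; right.
by rewrite maximal_opE; apply: ereal_sup_ubound; exists l.+1.
Qed.

Lemma measurable_running_max l n (M : X -> R) : measurable_fun setT M ->
  measurable_fun setT (fun x => running_max l n (M x) x).
Proof.
elim: n l M => [|n IH] l M mM //=.
apply: (IH l.+1 (fun x => Num.max (M x) (level_avg l.+1 x))).
by apply: measurable_maxr => //; exact: measurable_level_avg.
Qed.

End averages.

(** * The basic inequality for the maximal operator *)

(** In an inequality between possibly infinite quantities the finite terms can
    be exchanged for others. *)
Lemma lee_trade_EFin {R : realDomainType} (b b' c c' : R) (Z Y : \bar R) :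
  b' - c' <= b - c -> (b%:E + Z <= Y + c%:E -> b'%:E + Z <= Y + c'%:E)%E.
Proof.
move=> h hyp.
have -> : (b'%:E + Z = (b' - b)%:E + (b%:E + Z))%E by rewrite addeA -EFinD subrK.
apply: (le_trans (leeD2l _ hyp)).
by rewrite addeCA -EFinD leeD2l// lee_fin; lra.
Qed.

Lemma measurable_fun_powR d (X : measurableType d) (R : realType) (D : set X)
    (g : X -> R) (r : R) :
  measurable_fun D g -> measurable_fun D (fun x => g x `^ r).
Proof.
move=> mg; apply: (@measurableT_comp _ _ _ _ _ _ (@powR R ^~ r)) mg.
exact: measurable_powR.
Qed.

Lemma measurable_fun_poweR d (X : measurableType d) (R : realType) (D : set X)
    (g : X -> \bar R) (r : R) :
  measurable_fun D g -> measurable_fun D (fun x => g x `^ r)%E.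
Proof.
move=> mg; apply: (@measurableT_comp _ _ _ _ _ _ (@poweR R ^~ r)) mg.
exact: measurable_poweR.
Qed.

Lemma continuous_powR_gt0 {R : realType} (r x : R) : 0 < x ->
  {for x, continuous (@powR R ^~ r)}.
Proof.
move=> x0; apply: differentiable_continuous; apply/derivable1_diffP.
by have [] := is_derive1_powR r x0.
Qed.

Section maximal_inequality.
Context {R : realType} {d : measure_display} {X : measurableType d}.
Context {mu : probability X R} {N : nat}.
Context {T : set (set X)} {C : set X -> set (set X)}.
Hypothesis N_gt1 : (1 < N)%N.
Hypothesis tree : homogeneous_tree_with mu N T C.
Implicit Types (I J K : set X) (x : X).

Local Notation level := (tree_level C).
Local Notation child := (child tree).

Let mT J : T J -> measurable J. Proof. exact: (tree_measurable tree). Qed.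

Context {phi : X -> R} {f : R}.
Hypothesis mphi : measurable_fun setT phi.
Hypothesis phi0 : forall x, 0 <= phi x.
Hypothesis intphi : (\int[mu]_x (phi x)%:E = f%:E)%E.

Local Notation avg := (avg mu phi).
Local Notation level_avg := (level_avg mu C phi).
Local Notation W := (running_max mu C phi).

Context {p : R}.
Hypothesis p1 : 1 < p.
Let a := homogeneous_ratio N p : R.
Let a0 : 0 < a.
Proof. by have := @homogeneous_ratio_gt1 R N p N_gt1 p1; rewrite /a; lra. Qed.

Let mW l n M q : measurable_fun setT (fun x => (W l n M x `^ q)%:E).
Proof.
apply/measurable_EFinP.
apply: measurable_fun_powR.
apply: (@measurable_running_max _ _ _ mu N T C tree phi l n (fun=> M)).
exact: measurable_cst.
Qed.

Let mWphi l n M q : measurable_fun setT (fun x => (W l n M x `^ q * phi x)%:E).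
Proof.
apply/measurable_EFinP; apply: measurable_funM => //.
by apply/measurable_EFinP; exact: mW.
Qed.

(** The potential W^p - a W^(p-1) phi has a larger integral the more levels the
    running maximum W follows. In the inductive step a child J either leaves the
    maximum unchanged, or raises it from M to y = avg J with y <= N M, and then
    [jump_powR] applies. The terms are distributed on the two sides so that all
    of them are nonnegative and no integrability of W^p is needed. *)
Lemma running_max_potential n l I M : level l I -> 0 < M -> avg I <= M ->
  ((M `^ p * fine (mu I))%:E
      + a%:E * \int[mu]_(x in I) (W l n M x `^ (p - 1) * phi x)%:E
   <= \int[mu]_(x in I) (W l n M x `^ p)%:E
      + (a * (M `^ (p - 1) * (avg I * fine (mu I))))%:E)%E.
Proof.
elim: n l I M => [|n IH] l I M lI M0 IM.
  have TI := level_tree tree lI.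
  have muI : mu I \is a fin_num by rewrite fin_num_measure//; exact: mT.
  have -> : (\int[mu]_(x in I) (W l 0 M x `^ p)%:E = (M `^ p * fine (mu I))%:E)%E.
    by rewrite EFinM fineK// /= integral_cst//; exact: mT.
  rewrite /=.
  under eq_integral do rewrite EFinM.
  rewrite ge0_integralZl_EFin; first last.
  - exact: powR_ge0.
  - by apply: measurable_funTS; exact/measurable_EFinP.
  - by move=> x _; rewrite lee_fin.
  - exact: mT.
  rewrite (tree_integral_avg N_gt1 tree mphi phi0 intphi TI).
  by rewrite -!EFinM -!EFinD lee_fin.
have TI := level_tree tree lI.
have lc i : (i < N)%N -> level l.+1 (child I i) by exact: levelS.
have WE i x : (i < N)%N -> child I i x ->
    W l n.+1 M x = W l.+1 n (Num.max M (avg (child I i))) x.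
  by move=> iN ix; rewrite /= /level_avg (node_eq tree (lc i iN) ix).
rewrite !(ge0_integral_child tree TI)//; first last.
- by move=> x; rewrite lee_fin mulr_ge0// powR_ge0.
- by move=> x; rewrite lee_fin powR_ge0.
rewrite ge0_sume_distrr; last first.
  by move=> i _; apply: integral_ge0 => x _; rewrite lee_fin mulr_ge0// powR_ge0.
have muE : fine (mu I) = \sum_(i < N) fine (mu (child I i)).
  rewrite (eq_bigr (fun=> N%:R^-1 * fine (mu I))) => [|i _].
    rewrite sumr_const card_ord -[RHS]mulr_natl mulrA divff ?mul1r//.
    by rewrite gt_eqF// ltr0n ltnW.
  by rewrite (tree_mu_child tree)// fineM// fin_num_measure//; exact: mT.
have avgE : avg I * fine (mu I) =
    \sum_(i < N) avg (child I i) * fine (mu (child I i)).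
  apply: EFin_inj.
  rewrite -(tree_integral_avg N_gt1 tree mphi phi0 intphi TI) -sumEFin.
  rewrite (ge0_integral_child tree TI)//; last exact/measurable_EFinP.
  apply: eq_bigr => i _.
  exact: (tree_integral_avg N_gt1 tree mphi phi0 intphi (child_tree tree TI _)).
rewrite avgE muE !mulr_sumr -!sumEFin -!big_split /=.
apply: lee_sum => i _.
have iN := ltn_ord i.
have WiE q : (\int[mu]_(x in child I i) (W l n.+1 M x `^ q)%:E =
   \int[mu]_(x in child I i) (W l.+1 n (Num.max M (avg (child I i))) x `^ q)%:E)%E.
  by apply: eq_integral => x; rewrite inE => ix; rewrite (WE _ _ iN ix).
have WiphiE q : (\int[mu]_(x in child I i) (W l n.+1 M x `^ q * phi x)%:E =
   \int[mu]_(x in child I i)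
     (W l.+1 n (Num.max M (avg (child I i))) x `^ q * phi x)%:E)%E.
  by apply: eq_integral => x; rewrite inE => ix; rewrite (WE _ _ iN ix).
rewrite -/(W l n.+1 M) WiE WiphiE.
apply: lee_trade_EFin (IH l.+1 (child I i) _ (lc i iN) _ _); last 2 first.
- by rewrite lt_max M0.
- by rewrite le_max lexx orbT.
have trade y r : 0 < r -> y <= N%:R * avg I ->
    M `^ p * r - a * (M `^ (p - 1) * (y * r)) <=
    Num.max M y `^ p * r - a * (Num.max M y `^ (p - 1) * (y * r)).
  move=> r_gt0 yN;
  have [yM|My] := leP y M; first by rewrite lexx.
  have := @jump_powR R N p M y N_gt1 p1 M0.
  have -> : M <= y <= N%:R * M.
    by rewrite ltW//= (le_trans yN)// ler_wpM2l.
  move=> /(_ isT); rewrite -/a.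
  have := @mulr_powRB1 R y p (ltW (lt_trans M0 My)) (lt_trans ltr01 p1).
  move: (M `^ p) (M `^ (p - 1)) (y `^ p) (y `^ (p - 1)) => A B D E <-.
  nra.
apply: trade; first exact: (tree_mu_fine N_gt1 tree (child_tree tree TI iN)).
exact: (avg_child N_gt1 tree mphi phi0 intphi TI iN).
Qed.

(** The limit of [running_max_potential] from the root. On the left the last
    average is at most the running maximum and converges to phi almost
    everywhere, so Fatou's lemma produces the integral of phi^p; on the right
    the running maximum is at most max(u, M). *)
Lemma maximal_op_lower_bound u F : f <= u -> 0 < u ->
    (\int[mu]_x (phi x `^ p)%:E = F%:E)%E ->
  ((u `^ p + a * F)%:E <=
   \int[mu]_x (maxe u%:E (maximal_op mu T phi x) `^ p)
     + (a * (u `^ (p - 1) * f))%:E)%E.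
Proof.
move=> fu u0 intF.
set S := (\int[mu]_x _)%E.
have S0 : (0 <= S)%E by apply: integral_ge0 => x _; exact: poweR_ge0.
have mM : measurable_fun setT (fun x => maxe u%:E (maximal_op mu T phi x) `^ p)%E.
  apply: measurable_fun_poweR.
  apply: measurable_maxe => //.
  exact: (measurable_maximal_op tree mphi phi0 intphi).
pose Z n := (\int[mu]_x (W 0 n u x `^ (p - 1) * phi x)%:E)%E.
have key n : ((u `^ p)%:E + a%:E * Z n <= S + (a * (u `^ (p - 1) * f))%:E)%E.
  have := @running_max_potential n 0%N setT u erefl u0.
  rewrite (avg_setT intphi) => /(_ fu).
  have -> : fine (mu setT) = 1 by rewrite probability_setT.
  rewrite !mulr1 => /le_trans; apply; apply: leeD => //.
  apply: ge0_le_integral => //.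
    by move=> x _; rewrite lee_fin powR_ge0.
  move=> x _; rewrite -poweR_EFin; apply: gt0_ler_poweR.
  - by rewrite ltW// (lt_trans ltr01).
  - rewrite in_itv/= leey andbT lee_fin.
    by rewrite (le_trans (ltW u0))// running_max_ge.
  - by rewrite in_itv/= leey andbT le_max lee_fin (ltW u0).
  - exact: (running_max_le_maximal_op tree mphi phi0 intphi).
have mA n : measurable_fun setT (fun x => (level_avg n x `^ (p - 1) * phi x)%:E).
  apply/measurable_EFinP; apply: measurable_funM => //.
  apply: measurable_fun_powR.
  exact: (measurable_level_avg tree).
pose g n x := (level_avg n.+1 x `^ (p - 1) * phi x)%:E.
have g0 n x : (0 <= g n x)%E by rewrite lee_fin mulr_ge0// powR_ge0.
have FE : (F%:E = \int[mu]_x limn_einf (g ^~ x))%E.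
  rewrite -intF; apply: ge0_ae_eq_integral => //.
  - apply/measurable_EFinP.
    exact: measurable_fun_powR.
  - rewrite /limn_einf; apply: measurableT_comp => //.
    apply: measurable_fun_limn_esup => n.
    by apply: measurableT_comp => //; exact: mA.
  - by move=> x _; rewrite lee_fin powR_ge0.
  - move=> x _; rewrite limn_einf_lim; apply: lime_ge; first exact: is_cvg_einfs.
    near=> n; apply: le_ereal_inf_tmp => _ [k /= _ <-]; exact: g0.
  have iphi : mu.-integrable setT (EFin \o phi).
    apply/integrableP; split; first exact/measurable_EFinP.
    under eq_integral do rewrite /= ger0_norm//.
    by rewrite intphi ltry.
  have := tree_differentiates tree iphi.
  apply: filterS => x /(_ (node C ^~ x) (fun m => nodeP tree m x)) cx _.
  have {}cx : level_avg n x @[n --> \oo] --> phi x by exact: cx.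
  have cg : g n x @[n --> \oo] --> (phi x `^ p)%:E.
    apply: cvg_EFin; first by near=> n.
    (* The exponent p - 1 may be less than 1; the factor [phi x] saves the limit
       at the zeros of phi, where the power need not be differentiable. *)
    have := phi0 x; rewrite le_eqVlt => /orP[/eqP px0|px].
      rewrite -px0 powR0; last by rewrite gt_eqF// (lt_trans ltr01).
      rewrite (_ : _ \o _ = cst 0); first exact: cvg_cst.
      by apply/funext => n /=; rewrite -px0 mulr0.
    rewrite -(@mulr_powRB1 R (phi x) p) ?ltW//; last exact: lt_trans p1.
    rewrite mulrC; apply: cvgM; last exact: cvg_cst.
    apply: (@cvg_comp _ _ _ (fun n => level_avg n.+1 x) (@powR R ^~ (p - 1)) _
      (nbhs (phi x))).
      by have := cx; rewrite -cvg_shiftS.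
    exact: continuous_powR_gt0.
  by rewrite is_cvg_limn_einfE; [apply/esym/cvg_lim|apply/cvg_ex; eexists; exact: cg].
have [SE|Sfin] := eqVneq S +oo%E; first by rewrite SE addye// leey.
have {}Sfin : S \is a fin_num by rewrite ge0_fin_numE// ltey.
have Zc n : (Z n <= (a^-1 * (fine S + a * (u `^ (p - 1) * f) - u `^ p))%:E)%E.
  rewrite EFinM lee_pdivlMl// EFinB leeBrDl// EFinD fineK//.
have gZ n : (\int[mu]_x g n x <= Z n.+1)%E.
  apply: ge0_le_integral => //.
    exact: mA.
  move=> x _; rewrite lee_fin ler_wpM2r// ge0_ler_powR ?nnegrE//.
  - by rewrite subr_ge0 ltW.
  - exact: avg_ge0.
  - by rewrite (le_trans (ltW u0))// running_max_ge.
  - exact: (level_avg_le_running_max 0%N n).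
have : (F%:E <= (a^-1 * (fine S + a * (u `^ (p - 1) * f) - u `^ p))%:E)%E.
  rewrite FE.
  apply: le_trans (fatou mu measurableT (fun n => mA n.+1) (fun n x _ => g0 n x)) _.
  rewrite limn_einf_lim; apply: lime_le; first exact: is_cvg_einfs.
  near=> n; apply: le_trans (le_trans (gZ n) (Zc n.+1)).
  by apply: ereal_inf_lbound; exists n => /=.
rewrite lee_fin ler_pdivlMl// lerBrDr => h.
by rewrite -(fineK Sfin) -EFinD lee_fin; lra.
Unshelve. all: by end_near. Qed.

End maximal_inequality.

(** * The weak type inequality *)

Section lower_bound.
Context {R : realType} {d : measure_display} {X : measurableType d}.
Context {mu : probability X R} {N : nat}.
Context {T : set (set X)} {C : set X -> set (set X)}.
Hypothesis N_gt1 : (1 < N)%N.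
Hypothesis tree : homogeneous_tree_with mu N T C.
Implicit Types (I J K : set X) (x : X).

Local Notation level := (tree_level C).
Local Notation child := (child tree).

Let mT J : T J -> measurable J. Proof. exact: (tree_measurable tree). Qed.

Context {phi : X -> R} {f : R}.
Hypothesis mphi : measurable_fun setT phi.
Hypothesis phi0 : forall x, 0 <= phi x.
Hypothesis intphi : (\int[mu]_x (phi x)%:E = f%:E)%E.

Local Notation avg := (avg mu phi).
Local Notation level_avg := (level_avg mu C phi).
Local Notation W := (running_max mu C phi).
Local Notation M := (maximal_op mu T phi).

Lemma running_max_max l n (s t : R) x :
  W l n (Num.max s t) x = Num.max s (W l n t x).
Proof. by elim: n l t => [|n IH] l t //=; rewrite -maxA IH. Qed.

Let S l n (s r : R) := [set x | r <= W l n s x].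

Let mS l n s r : measurable (S l n s r).
Proof.
have mW := @measurable_running_max _ _ _ mu N T C tree phi l n (fun=> s)
  (measurable_cst _).
have := mW measurableT _ (measurable_itv `[r, +oo[).
rewrite setTI; congr measurable; apply/seteqP; split=> x /=;
  by rewrite /S /= in_itv/= andbT.
Qed.

(** If the average over I reaches r, then r mu(I) is at most the integral over
    I; otherwise the average over I does not contribute to the maximum, and the
    estimate is summed over the children. *)
Lemma running_max_weak_type n l I r : level l I -> 0 < r ->
  (r%:E * \int[mu]_(x in I) (\1_(S l n (avg I) r) x)%:E <=
   \int[mu]_(x in I) (phi x)%:E)%E.
Proof.
move=> lI0 r0; have high k j K : level j K -> r <= avg K ->
    (r%:E * \int[mu]_(x in K) (\1_(S j k (avg K) r) x)%:E <=
     \int[mu]_(x in K) (phi x)%:E)%E.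
  move=> /(level_tree tree) TI rI.
  rewrite integral_indic//; last exact: mT.
  apply: (@le_trans _ _ (r%:E * mu K)%E).
    rewrite lee_pmul2l//; apply: le_measure; rewrite ?inE; last exact: subIsetr.
    + by apply: measurableI => //; exact: mT.
    + exact: mT.
  rewrite (tree_integral_avg N_gt1 tree mphi phi0 intphi TI) EFinM.
  rewrite fineK ?fin_num_measure//; last exact: mT.
  by rewrite lee_wpmul2r.
elim: n l I lI0 => [|n IH] l I lI; have TI := level_tree tree lI;
  (have [rI|Ir] := leP r (avg I); first exact: high).
  rewrite (_ : S l 0 (avg I) r = set0); last first.
    by apply/seteqP; split=> // x; rewrite /S /= leNgt Ir.
  under eq_integral do rewrite indic0.
  by rewrite integral0 mule0; apply: integral_ge0 => x _; rewrite lee_fin.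
rewrite !(ge0_integral_child tree TI)//; first last.
- by apply/measurable_EFinP; apply: measurable_indic; exact: mS.
- exact/measurable_EFinP.
rewrite ge0_sume_distrr; last first.
  by move=> i _; apply: integral_ge0 => x _; rewrite lee_fin.
apply: lee_sum => i _; have iN := ltn_ord i.
have lc : level l.+1 (child I i) by exact: levelS.
rewrite (eq_integral (fun x => (\1_(S l.+1 n (avg (child I i)) r) x)%:E)).
  exact: IH.
move=> x; rewrite inE => ix; congr EFin.
rewrite !indicE; congr (_%:R); congr nat_of_bool.
apply/idP/idP; rewrite !inE /S /=; rewrite /level_avg (node_eq tree lc ix).
  by rewrite running_max_max le_max leNgt Ir.
by move=> h; rewrite running_max_max le_max h orbT.
Qed.

(** The sets where the running maximum over n levels reaches r increase with n
    and cover the set on the left. *)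
Lemma maximal_op_weak_type r : 0 < r ->
  (r%:E * mu [set x | r%:E < M x] <= f%:E)%E.
Proof.
move=> r0; pose V n := S 0%N n (avg setT) r.
have Vle n : (r%:E * mu (V n) <= f%:E)%E.
  have := @running_max_weak_type n 0%N setT r erefl r0.
  by rewrite intphi integral_indic// setIT.
have ndV : {homo V : n m / (n <= m)%N >-> (n <= m)%O}.
  move=> n m nm; apply/subsetPset => x; rewrite /V /S /= => /le_trans; apply.
  have -> : m = (n + (m - n))%N by rewrite subnKC.
  elim: (n) (0%N) (avg setT) (m - n)%N => [|k IH] l s j /=.
    exact: running_max_ge.
  exact: IH.
have cV := nondecreasing_cvg_mu (mu := mu) (fun n => mS _ _ _ _)
  (bigcupT_measurable V (fun n => mS _ _ _ _)) ndV.
rewrite -lee_pdivlMl//.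
apply: (@le_trans _ _ (mu (\bigcup_n V n))).
  apply: le_measure; rewrite ?inE; last 1 first.
  - move=> x /=; rewrite (maximal_opE tree mphi phi0 intphi).
    move=> /ereal_sup_gt[_ [n _ <-]]; rewrite lte_fin => /ltW rn.
    exists n => //; rewrite /V /S /=; case: n rn => [|n] rn.
      by rewrite /= -(@node_eq _ _ _ _ _ _ _ tree 0%N setT x).
    exact: le_trans (level_avg_le_running_max 0%N n _ _).
  - have mM := measurable_maximal_op tree mphi phi0 intphi.
    have := mM measurableT _ (emeasurable_itv `]r%:E, +oo[).
    rewrite setTI; congr measurable; apply/seteqP; split=> x /=;
    by rewrite in_itv/= andbT.
  - by apply: bigcupT_measurable => n; exact: mS.
rewrite -(cvg_lim _ cV)//; apply: lime_le.
  by apply/cvg_ex; eexists; exact: cV.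
by apply: nearW => n /=; rewrite lee_pdivlMl//; exact: Vle.
Qed.

End lower_bound.

(** * Superlevel sets of measure kappa *)

Section superlevel_sets.
Context {R : realType} {d : measure_display} {X : measurableType d}.
Context {mu : probability X R} {N : nat}.
Context {T : set (set X)} {C : set X -> set (set X)}.
Hypothesis N_gt1 : (1 < N)%N.
Hypothesis tree : homogeneous_tree_with mu N T C.
Implicit Types (I J K : set X) (x : X).

Context {phi : X -> R} {f : R}.
Hypothesis mphi : measurable_fun setT phi.
Hypothesis phi0 : forall x, 0 <= phi x.
Hypothesis intphi : (\int[mu]_x (phi x)%:E = f%:E)%E.
Hypothesis f_gt0 : 0 < f.

Local Notation M := (maximal_op mu T phi).

Let mM : measurable_fun setT M := measurable_maximal_op tree mphi phi0 intphi.

Let measurable_gt r : measurable [set x | r%:E < M x]%E.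
Proof.
have := mM measurableT (emeasurable_itv `]r%:E, +oo[).
rewrite setTI; congr measurable; apply/seteqP; split=> x /=;
by rewrite in_itv/= andbT.
Qed.

Let measurable_ge r : measurable [set x | r%:E <= M x]%E.
Proof.
have := mM measurableT (emeasurable_itv `[r%:E, +oo[).
rewrite setTI; congr measurable; apply/seteqP; split=> x /=;
by rewrite in_itv/= andbT.
Qed.

(** The level u is the supremum of those r for which the maximal function is at
    least r on a set of measure at least kappa; f is such an r, and the weak
    type inequality bounds them by f / kappa. *)
Lemma maximal_op_quantile (kappa : R) : 0 < kappa -> kappa <= 1 ->
  exists u : R, [/\ f <= u, u * kappa <= f,
    (mu [set x | u%:E < M x] <= kappa%:E)%E &
    (kappa%:E <= mu [set x | u%:E <= M x])%E].
Proof.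
move=> k0 k1.
pose L := [set r : R | kappa%:E <= mu [set x | r%:E <= M x]]%E.
have Lf : L f.
  rewrite /L /= (_ : [set x | _] = setT) ?probability_setT ?lee_fin//.
  apply/seteqP; split=> // x _ /=.
  exact: (maximal_op_ge_mean tree mphi phi0 intphi).
have Lub r : L r -> r * kappa <= f.
  move=> Lr; have [r0|r0] := leP r 0.
    by apply: le_trans (ltW f_gt0); rewrite mulr_le0_ge0// ltW.
  apply/ler_addgt0Pr => e e0.
  (* Halving keeps s positive even when e exceeds r. *)
  pose s := Num.max (r / 2) (r - e).
  have s0 : 0 < s by rewrite lt_max divr_gt0.
  have sr : s < r by rewrite gt_max; apply/andP; split; lra.
  have := maximal_op_weak_type N_gt1 tree mphi phi0 intphi s0.
  have : (s%:E * kappa%:E <= s%:E * mu [set x | s%:E < M x])%E.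
    rewrite lee_pmul2l//; apply: (le_trans Lr).
    apply: le_measure; rewrite ?inE// => x /=.
    by apply: lt_le_trans; rewrite lte_fin.
  move=> /le_trans h /h; rewrite -EFinM lee_fin.
  have : r - e <= s by rewrite le_max lexx orbT.
  nra.
have Lhs : has_sup L.
  split; first by exists f.
  by exists (f / kappa) => r Lr; rewrite ler_pdivlMr// Lub.
pose u := sup L.
have fu : f <= u by apply: sup_ubound => //; case: Lhs.
exists u; split => //.
- rewrite -ler_pdivlMr//; apply: ge_sup => [|r Lr]; first by exists f.
  by rewrite ler_pdivlMr// Lub.
- pose V n := [set x | (u + n.+1%:R^-1)%:E <= M x]%E.
  have -> : [set x | (u%:E < M x)%E] = \bigcup_n V n.
    apply/seteqP; split=> x /=.
      case ME : (M x) => [r| |]//=.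
        rewrite lte_fin => /ltr_add_invr[n nr]; exists n => //.
        by rewrite /V /= ME lee_fin ltW.
      by move=> _; exists 0%N; rewrite // /V /= ME leey.
    by move=> [n _]; apply: lt_le_trans; rewrite lte_fin ltrDl invr_gt0 ltr0n.
  have ndV : {homo V : n m / (n <= m)%N >-> (n <= m)%O}.
    move=> n m nm; apply/subsetPset => x; rewrite /V /=; apply: le_trans.
    by rewrite lee_fin lerD2l lef_pV2 ?posrE ?ltr0n// ler_nat.
  have cV := nondecreasing_cvg_mu (mu := mu) (fun n => measurable_ge _)
    (bigcupT_measurable V (fun n => measurable_ge _)) ndV.
  rewrite -(cvg_lim _ cV)//; apply: lime_le.
    by apply/cvg_ex; eexists; exact: cV.
  apply: nearW => n /=; rewrite leNgt; apply/negP => /ltW LV.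
  have : u + n.+1%:R^-1 <= u by apply: sup_ubound => //; case: Lhs.
  by rewrite gerDl leNgt invr_gt0 ltr0n.
- pose V n := [set x | (u - n.+1%:R^-1)%:E <= M x]%E.
  have -> : [set x | (u%:E <= M x)%E] = \bigcap_n V n.
    apply/seteqP; split=> x /=.
      by move=> uM n _; apply: le_trans uM; rewrite lee_fin gerBl invr_ge0 ler0n.
    move=> Vx; rewrite leNgt; apply/negP.
    case ME : (M x) => [r| |]//=.
      rewrite lte_fin => /ltr_add_invr[n]; rewrite -ltrBrDr -lte_fin -ME ltNge.
      by rewrite (Vx n).
    by move=> _; have := Vx 0%N I; rewrite /V /= ME.
  have ndV : {homo V : n m / (n <= m)%N >-> (m <= n)%O}.
    move=> n m nm; apply/subsetPset => x; rewrite /V /=; apply: le_trans.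
    by rewrite lee_fin lerB// lef_pV2 ?posrE ?ltr0n// ler_nat.
  have V0 : (mu (V 0%N) < +oo)%E.
    by rewrite ltey_eq fin_num_measure//; exact: measurable_ge.
  have cV := nonincreasing_cvg_mu V0 (fun n => measurable_ge _)
    (bigcapT_measurable (fun n => measurable_ge _)) ndV.
  rewrite -(cvg_lim _ cV)//.
  apply: lime_ge.
    by apply/cvg_ex; eexists; exact: cV.
  apply: nearW => n /=.
  have e0 : 0 < n.+1%:R^-1 :> R by rewrite invr_gt0 ltr0n.
  have [r Lr ur] := sup_adherent e0 Lhs.
  apply: (le_trans Lr); apply: le_measure; rewrite ?inE; first exact: measurable_ge.
    exact: measurable_ge.
  by move=> x /=; apply: le_trans; rewrite lee_fin ltW.
Qed.

(** To [M > u] one adds a part of [M = u] of the missing measure, cut out by a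
    packing. *)
Lemma exists_superlevel_set (kappa u : R) :
    (mu [set x | u%:E < M x] <= kappa%:E)%E ->
    (kappa%:E <= mu [set x | u%:E <= M x])%E ->
  exists E : set X, [/\ measurable E, mu E = kappa%:E,
    [set x | u%:E < M x]%E `<=` E & E `<=` [set x | u%:E <= M x]%E].
Proof.
set A := [set x | (u%:E < M x)%E]; set A' := [set x | (u%:E <= M x)%E] => Ak kA'.
have mA : measurable A by exact: measurable_gt.
have mA' : measurable A' by exact: measurable_ge.
have AA' : A `<=` A' by move=> x; exact: ltW.
pose B := A' `\` A.
have mB : measurable B by exact: measurableD.
have muA : mu A \is a fin_num by rewrite fin_num_measure.
have A'E : (mu A' = mu A + mu B)%E.
  rewrite -measureU ?setDUK//; last by rewrite setDIK.
have [|||G [GT tG _ BG]] := @tree_packing _ _ _ mu N T C N_gt1 tree B setT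
  (kappa - fine (mu A)) mB.
- exact: tree_root tree.
- by rewrite subr_ge0 -lee_fin fineK.
- by rewrite setIT EFinB fineK// leeBlDl// -A'E.
have mG : measurable (\bigcup_(J in G) J).
  apply: countable_union_measurable.
    by apply: sub_countable (tree_countable tree); exact: subset_card_le.
  by move=> J /GT; exact: (tree_measurable tree).
exists (A `|` (B `&` \bigcup_(J in G) J)); split.
- by apply: measurableU => //; exact: measurableI.
- transitivity (mu A + mu (B `&` \bigcup_(J in G) J))%E.
    by apply: measureU => //; [exact: measurableI|rewrite setIA setDIK set0I].
  by rewrite BG EFinB fineK// addeCA subee// adde0.
- exact: subsetUl.
- by move=> x [/AA'//|[[]]].
Qed.

(** Outside E the maximal function is at most u, so max(u, M)^p contributes
    exactly (1 - kappa) u^p there. *)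
Lemma superlevel_set_integral (u F p kappa : R) E : 1 < p -> f <= u ->
    (\int[mu]_x (phi x `^ p)%:E = F%:E)%E ->
    measurable E -> mu E = kappa%:E ->
    [set x | u%:E < M x]%E `<=` E -> E `<=` [set x | u%:E <= M x]%E ->
  ((bellman_candidate N p F f kappa u)%:E <= \int[mu]_(x in E) (M x `^ p))%E.
Proof.
move=> p1 fu intF mE muE AE EA.
have u0 : 0 < u by exact: lt_le_trans fu.
have := maximal_op_lower_bound N_gt1 tree mphi phi0 intphi p1 fu u0 intF.
have mMx : measurable_fun setT (fun x => maxe u%:E (M x) `^ p)%E.
  by apply: measurable_fun_poweR; exact: measurable_maxe.
rewrite -(setUv E) ge0_integral_setU//; first last.
- by apply/disj_setPCl.
- by move=> x _; exact: poweR_ge0.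
- by rewrite setUv.
- exact: measurableC.
have -> : (\int[mu]_(x in E) (maxe u%:E (M x) `^ p) =
    \int[mu]_(x in E) (M x `^ p))%E.
  by apply: eq_integral => x; rewrite inE => /EA/= uM; rewrite max_r.
have -> : (\int[mu]_(x in ~` E) (maxe u%:E (M x) `^ p) =
    (u `^ p * (1 - kappa))%:E)%E.
  rewrite (eq_integral (cst (u `^ p)%:E)) => [|x]; last first.
    rewrite inE => nE /=; rewrite max_l// leNgt; apply/negP => uM; apply: nE.
    exact: AE.
  rewrite integral_cst; last exact: measurableC.
  by rewrite EFinM EFinB -muE; congr (_ * _)%E; exact: probability_setC.
set S := (\int[mu]_(x in E) _)%E.
have : (0 <= S)%E by apply: integral_ge0 => x _; exact: poweR_ge0.
case: S => [s| |] // s0; last by move=> _; rewrite leey.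
rewrite -!EFinD !lee_fin /bellman_candidate; lra.
Qed.

(** If the quantile u is beyond U = (F/f)^(1/(p-1)), the second term of the
    candidate vanishes at U, and M >= U on E already gives the bound kappa U^p. *)
Lemma exists_bellman_candidate_le (F p kappa : R) :
    1 < p -> 0 < kappa -> kappa <= 1 ->
    f `^ p <= F -> (\int[mu]_x (phi x `^ p)%:E = F%:E)%E ->
  exists u, f <= u <= Num.min ((F / f) `^ (p - 1)^-1) (f / kappa) /\
  ((bellman_candidate N p F f kappa u)%:E <=
   ereal_sup [set \int[mu]_(x in E) (M x `^ p)
             | E in [set E | measurable E /\ mu E = kappa%:E]])%E.
Proof.
move=> p1 k0 k1 fpF intF.
have [u [fu uk uA uA']] := maximal_op_quantile k0 k1.
have [E [mE muE AE EA]] := exists_superlevel_set uA uA'.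
have pm0 : 0 < p - 1 by rewrite subr_gt0.
have F0 : 0 < F by apply: lt_le_trans fpF; exact: powR_gt0.
set U := (F / f) `^ (p - 1)^-1.
have U0 : 0 < U by rewrite powR_gt0// divr_gt0.
have Up : U `^ (p - 1) = F / f.
  by rewrite powR_invK// ltW// divr_gt0.
have fU : f <= U.
  apply: le_powR_inv => //; [exact: ltW|by rewrite ltW// divr_gt0|].
  by rewrite ler_pdivlMr// mulrC mulr_powRB1 ?(ltW f_gt0) ?(lt_trans ltr01 p1).
have [uU|Uu] := leP u U.
  exists u; rewrite fu le_min uU ler_pdivlMr//; split => //.
  apply: (le_trans (superlevel_set_integral p1 fu intF mE muE AE EA)).
  by apply: ereal_sup_ubound; exists E.
exists U; rewrite fU le_min lexx ler_pdivlMr//=; split.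
  by apply: le_trans uk; rewrite ler_pM2r// ltW.
rewrite /bellman_candidate Up divfK ?gt_eqF// subrr mulr0 addr0.
apply: (@le_trans _ _ (\int[mu]_(x in E) (M x `^ p))%E); last first.
  by apply: ereal_sup_ubound; exists E.
rewrite mulrC EFinM -muE -integral_cst//; apply: ge0_le_integral => //.
- by move=> x _; rewrite lee_fin powR_ge0.
- apply: measurable_funTS.
  exact: measurable_fun_poweR.
- move=> x /EA/= uM; rewrite -poweR_EFin; apply: gt0_ler_poweR.
  + by rewrite ltW// (lt_trans ltr01).
  + by rewrite in_itv/= leey andbT lee_fin ltW.
  + rewrite in_itv/= leey andbT (le_trans _ uM)// lee_fin.
    by rewrite (le_trans (ltW f_gt0)).
  + by apply: le_trans uM; rewrite lee_fin ltW.
Qed.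

End superlevel_sets.

(** * The generations of the extremal construction *)

Section cascade.
Context {R : realType} {d : measure_display} {X : measurableType d}.
Context {mu : probability X R} {N : nat}.
Context {T : set (set X)} {C : set X -> set (set X)}.
Hypothesis N_gt1 : (1 < N)%N.
Hypothesis tree : homogeneous_tree_with mu N T C.
Implicit Types (I J K A : set X) (x : X) (G : set (set X)).

Local Notation level := (tree_level C).
Local Notation child := (child tree).
Local Notation m := (fun A => fine (mu A)).

Let N_gt0 : (0 < N)%N. Proof. exact: ltnW. Qed.
Let mT J : T J -> measurable J. Proof. exact: (tree_measurable tree). Qed.

Lemma tree_nested I J x : T I -> T J -> I x -> J x -> I `<=` J \/ J `<=` I.
Proof.
move=> /(tree_level_ex tree)[i iI] /(tree_level_ex tree)[j jJ] Ix Jx.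
have [ij|/ltnW ji] := leqP i j.
  right; apply: (@level_nested _ _ _ _ _ _ _ tree i (j - i) J I x) => //.
  by rewrite subnKC.
left; apply: (@level_nested _ _ _ _ _ _ _ tree j (i - j) I J x) => //.
by rewrite subnKC.
Qed.

(** In a tree there is no element strictly between J and its child. *)
Lemma tree_nested_child I J i x : T I -> T J -> (i < N)%N ->
  I x -> child J i x -> I `<=` child J i \/ J `<=` I.
Proof.
move=> /(tree_level_ex tree)[k kI] /(tree_level_ex tree)[l lJ] iN Ix cx.
have [kl|lk] := leqP k l.
  right; apply: (@level_nested _ _ _ _ _ _ _ tree k (l - k) J I x) => //.
    by rewrite subnKC.
  exact: (child_sub (level_tree tree lJ) iN cx).
left; apply: (@level_nested _ _ _ _ _ _ _ tree l.+1 (k - l.+1) I _ x) => //.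
  by rewrite subnKC.
exact: levelS.
Qed.

Lemma tree_family_measurable G : G `<=` T -> measurable (\bigcup_(J in G) J).
Proof.
move=> GT; apply: countable_union_measurable; last by move=> J /GT/mT.
by apply: sub_countable (tree_countable tree); exact: subset_card_le.
Qed.

Lemma tree_family_countable G : G `<=` T -> countable G.
Proof.
by move=> GT; apply: sub_countable (tree_countable tree); exact: subset_card_le.
Qed.

Context {s delta : R}.
Hypothesis s01 : 0 <= s <= 1.
Hypothesis delta01 : 0 <= delta <= 1.

(** A packing, made into a function of K so that the construction can be
    iterated. *)
Lemma portion_ex : exists g : set X -> set (set X), forall K, T K ->
  [/\ g K `<=` T, trivIset (g K) id, forall J, g K J -> J `<=` K &
      mu (\bigcup_(J in g K) J) = (delta%:E * mu K)%E].
Proof.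
have /choice[g gP] : forall K, exists G, T K ->
    [/\ G `<=` T, trivIset G id, forall J, G J -> J `<=` K &
      mu (\bigcup_(J in G) J) = (delta%:E * mu K)%E].
  move=> K; have [TK|] := pselect (T K); last by exists set0.
  have muK : mu K \is a fin_num by rewrite fin_num_measure//; exact: mT.
  have /andP[d0 d1] := delta01.
  have [||G [GT tG GK muG]] :=
    @tree_packing _ _ _ mu N T C N_gt1 tree setT K (delta * m K) measurableT TK.
  - by rewrite mulr_ge0// fine_ge0.
  - by rewrite setTI -[leRHS]fineK// lee_fin ler_piMl// fine_ge0.
  exists G => _; split => //.
  by rewrite -[X in (_ * X)%E]fineK// -EFinM -muG setTI.
by exists g.
Qed.

Definition portion : set X -> set (set X) := projT1 (cid portion_ex).

Lemma portionP K : T K ->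
  [/\ portion K `<=` T, trivIset (portion K) id,
      forall J, portion K J -> J `<=` K &
      mu (\bigcup_(J in portion K) J) = (delta%:E * mu K)%E].
Proof. exact: (projT2 (cid portion_ex)). Qed.

Lemma initial_ex : exists G, [/\ G `<=` T, trivIset G id &
  mu (\bigcup_(J in G) J) = s%:E].
Proof.
have /andP[s0 s1] := s01.
have [|G [GT tG _ muG]] :=
  @tree_packing _ _ _ mu N T C N_gt1 tree setT setT s measurableT (tree_root tree) s0.
- by rewrite setTI probability_setT lee_fin.
by exists G; split => //; move: muG; rewrite setTI.
Qed.

Definition initial : set (set X) := projT1 (cid initial_ex).

(** The generations of the construction. Which child receives the mass is
    arbitrary; the first one is taken. When delta < 1, the extremal function has
    average u N^n on each element of generation n. *)
Fixpoint heavy (n : nat) : set (set X) :=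
  if n is n'.+1 then
    [set child J 0%N | J in \bigcup_(K in heavy n') portion K]
  else initial.

Definition parents n : set (set X) := \bigcup_(K in heavy n) portion K.

Lemma heavyS n : heavy n.+1 = [set child J 0%N | J in parents n].
Proof. by []. Qed.

Lemma portions_tree_disjoint G : G `<=` T -> trivIset G id ->
  (\bigcup_(K in G) portion K) `<=` T /\
  trivIset (\bigcup_(K in G) portion K) id.
Proof.
move=> GT tG; split.
  by move=> J [K /GT/portionP[pT _ _ _]]; exact: pT.
move=> J J' [K GK KJ] [K' GK' KJ'] [x [Jx J'x]].
have [_ tK KK _] := portionP (GT _ GK).
have [_ _ KK' _] := portionP (GT _ GK').
have KE : K = K' by apply: (tG) => //; exists x; split; [exact: KK Jx|exact: KK' J'x].
by apply: tK => //; [rewrite KE|exists x].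
Qed.

Lemma heavy_tree_disjoint n : heavy n `<=` T /\ trivIset (heavy n) id.
Proof.
elim: n => [|n [hT hD]].
  by have [] := projT2 (cid initial_ex).
have [pT pD] := portions_tree_disjoint hT hD.
rewrite heavyS; split.
  by move=> _ [J /pT TJ <-]; exact: child_tree.
move=> _ _ [J pJ <-] [J' pJ' <-] [x [Jx J'x]].
suff -> : J = J' by [].
apply: pD => //; exists x; split.
  exact: (child_sub (pT _ pJ) N_gt0 Jx).
exact: (child_sub (pT _ pJ') N_gt0 J'x).
Qed.

Lemma heavy_tree n : heavy n `<=` T.
Proof. by have [] := heavy_tree_disjoint n. Qed.

Lemma heavy_disjoint n : trivIset (heavy n) id.
Proof. by have [] := heavy_tree_disjoint n. Qed.

Lemma parents_tree n : parents n `<=` T.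
Proof.
by have [] := portions_tree_disjoint (@heavy_tree n) (@heavy_disjoint n).
Qed.

Lemma parents_disjoint n : trivIset (parents n) id.
Proof.
by have [] := portions_tree_disjoint (@heavy_tree n) (@heavy_disjoint n).
Qed.

Definition heavy_set n : set X := \bigcup_(J in heavy n) J.
Definition parent_set n : set X := \bigcup_(J in parents n) J.
(** The part of generation n on which the extremal function keeps the value u
    N^n. *)
Definition plateau n : set X := heavy_set n `\` parent_set n.

Lemma heavy_setS_sub n : heavy_set n.+1 `<=` parent_set n.
Proof.
move=> x [_ [J pJ <-] Jx]; exists J => //.
exact: (child_sub (parents_tree pJ) N_gt0 Jx).
Qed.

Lemma parent_set_sub n : parent_set n `<=` heavy_set n.
Proof.
move=> x [J [K hK KJ] Jx]; exists K => //.
by have [_ _ KK _] := portionP (heavy_tree hK); exact: KK Jx.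
Qed.

Lemma heavy_set_sub n k : heavy_set (n + k)%N `<=` heavy_set n.
Proof.
elim: k => [|k IH]; rewrite ?addn0 ?addnS//.
by move=> x /heavy_setS_sub/parent_set_sub; exact: IH.
Qed.

Lemma measurable_heavy_set n : measurable (heavy_set n).
Proof. by apply: tree_family_measurable; exact: heavy_tree. Qed.

Lemma measurable_parent_set n : measurable (parent_set n).
Proof. by apply: tree_family_measurable; exact: parents_tree. Qed.

Lemma measurable_plateau n : measurable (plateau n).
Proof.
by apply: measurableD; [exact: measurable_heavy_set|exact: measurable_parent_set].
Qed.

Lemma trivIset_plateau : trivIset setT plateau.
Proof.
move=> i j _ _ [x [ix jx]]; have [ij|ji|//] := ltngtP i j.
- have [_ []] := ix; have [jx' _] := jx; apply: heavy_setS_sub.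
  by apply: (@heavy_set_sub i.+1 (j - i.+1)); rewrite subnKC.
- have [_ []] := jx; have [ix' _] := ix; apply: heavy_setS_sub.
  by apply: (@heavy_set_sub j.+1 (i - j.+1)); rewrite subnKC.
Qed.

Lemma parent_set_cap_heavy n K : heavy n K ->
  parent_set n `&` K = \bigcup_(J in portion K) J.
Proof.
move=> hK; apply/seteqP; split=> x.
  move=> [[J [K' hK' KJ] Jx] Kx]; have [_ _ KK _] := portionP (heavy_tree hK').
  have -> : K = K'.
    by apply: (@heavy_disjoint n) => //; exists x; split => //; exact: KK Jx.
  by exists J.
move=> [J KJ Jx]; split; first by exists J => //; exists K.
by have [_ _ KK _] := portionP (heavy_tree hK); exact: KK Jx.
Qed.

Lemma heavy_set_cap_parents n J : parents n J -> heavy_set n.+1 `&` J = child J 0%N.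
Proof.
move=> pJ; apply/seteqP; split=> x.
  move=> [[_ [J' pJ' <-] J'x] Jx].
  suff -> : J = J' by [].
  apply: (@parents_disjoint n) => //; exists x; split => //.
  exact: (child_sub (parents_tree pJ') N_gt0 J'x).
move=> Jx; split; first by exists (child J 0%N) => //; exists J.
exact: (child_sub (parents_tree pJ) N_gt0 Jx).
Qed.

Lemma mu_parent_set n : mu (parent_set n) = (delta%:E * mu (heavy_set n))%E.
Proof.
have /andP[d0 d1] := delta01.
have := @measure_tiling_proportional _ _ _ mu (heavy n) (parent_set n) setT delta
  (tree_family_countable (@heavy_tree n)) _ (@heavy_disjoint n)
  (measurable_parent_set n) measurableT d0.
rewrite setTI -/(heavy_set n) (setIidl (@parent_set_sub n)); apply.
  by move=> J /heavy_tree/mT.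
move=> K hK; rewrite setTI parent_set_cap_heavy//.
by have [] := portionP (heavy_tree hK).
Qed.

(** A parent that meets I is contained in I, and so is its first child, with the
    fraction 1/N of the measure. *)
Lemma mu_heavy_setS I n : measurable I ->
    (forall J x, parents n J -> J x -> I x -> J `<=` I) ->
  mu (I `&` heavy_set n.+1) = (N%:R^-1%:E * mu (I `&` parent_set n))%E.
Proof.
move=> mI Isat.
have := @measure_tiling_proportional _ _ _ mu (parents n) (I `&` heavy_set n.+1)
  (I `&` parent_set n) N%:R^-1 (tree_family_countable (@parents_tree n)) _
  (@parents_disjoint n).
rewrite -/(parent_set n) -!setIA (setIidl (@heavy_setS_sub n)) setIid; apply.
- by move=> J /parents_tree/mT.
- by apply: measurableI => //; exact: measurable_heavy_set.
- by apply: measurableI => //; exact: measurable_parent_set.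
- by rewrite invr_ge0.
have PJ J : parents n J -> parent_set n `&` J = J.
  by move=> pJ; apply: setIidr => x Jx; exists J.
move=> J pJ; rewrite -!setIA heavy_set_cap_parents// PJ//.
have [IJ0|/set0P[x [Ix Jx]]] := eqVneq (I `&` J) set0.
  rewrite IJ0 measure0 mule0 (_ : _ `&` _ = set0) ?measure0//.
  apply/seteqP; split=> // x [Ix /(child_sub (parents_tree pJ) N_gt0) Jx].
  by rewrite -IJ0.
have JI := Isat J x pJ Jx Ix.
rewrite (setIidr JI) (setIidr (subset_trans (child_sub (parents_tree pJ) N_gt0) JI)).
exact: (tree_mu_child tree (parents_tree pJ) N_gt0).
Qed.

End cascade.

(** * The extremal function *)

Section step_functions.
Context {R : realType} {d : measure_display} {X : measurableType d}.
Context {mu : {measure set X -> \bar R}} {D : nat -> set X}.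
Hypothesis mD : forall k, measurable (D k).
Hypothesis tD : trivIset setT D.
Implicit Types (h : nat -> R) (x : X).

Definition step_series (D : nat -> set X) h x : \bar R :=
  (\sum_(0 <= k <oo) (h k * \1_(D k) x)%:E)%E.

Definition step_fun (D : nat -> set X) h x : R := fine (step_series D h x).

Lemma step_series_in h k x : (forall k, 0 <= h k) -> D k x ->
  step_series D h x = (h k)%:E.
Proof.
move=> h0 kx; rewrite /step_series (@nneseriesD1 _ _ k)//; last first.
  by move=> i _; rewrite lee_fin mulr_ge0.
rewrite indicE mem_set// mulr1 eseries0 ?adde0// => i _ /andP[_ ik].
rewrite indicE memNset ?mulr0// => ix.
by move/eqP: ik; apply; apply: tD => //; exists x.
Qed.

Lemma step_series_out h x : (forall k, ~ D k x) -> step_series D h x = 0%E.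
Proof.
by move=> nx; rewrite /step_series eseries0// => i _ _; rewrite indicE memNset ?mulr0.
Qed.

Lemma step_funE h x : (forall k, 0 <= h k) ->
  (step_fun D h x)%:E = step_series D h x.
Proof.
move=> h0; rewrite /step_fun; have [[k kx]|nx] := pselect (exists k, D k x).
  by rewrite (step_series_in h0 kx).
by rewrite step_series_out// => k kx; apply: nx; exists k.
Qed.

Lemma step_fun_ge0 h x : (forall k, 0 <= h k) -> 0 <= step_fun D h x.
Proof.
move=> h0; apply: fine_ge0; apply: nneseries_ge0 => k _ _.
by rewrite lee_fin mulr_ge0.
Qed.

Let m1 h k : measurable_fun setT (fun x => (h k * \1_(D k) x)%:E).
Proof.
apply/measurable_EFinP; apply: measurable_funM; first exact: measurable_cst.
exact: measurable_indic.
Qed.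

Lemma measurable_step_fun h : (forall k, 0 <= h k) ->
  measurable_fun setT (step_fun D h).
Proof.
move=> h0; apply/measurable_EFinP.
rewrite (_ : _ \o _ = step_series D h); last by apply/funext => x; exact: step_funE.
have := @ge0_emeasurable_sum _ _ R setT (fun k x => (h k * \1_(D k) x)%:E) predT.
apply => //; by move=> k x _ _; rewrite lee_fin mulr_ge0.
Qed.

Lemma integral_step_fun h A : (forall k, 0 <= h k) -> measurable A ->
  (\int[mu]_(x in A) (step_fun D h x)%:E =
   \sum_(0 <= k <oo) (h k)%:E * mu (A `&` D k))%E.
Proof.
move=> h0 mA; under eq_integral do rewrite step_funE//.
rewrite integral_nneseries//; first last.
- by move=> k x _; rewrite lee_fin mulr_ge0.
- by move=> k; apply: measurable_funTS; exact: m1.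
apply: eq_eseriesr => k _.
under eq_integral do rewrite EFinM.
rewrite ge0_integralZl_EFin//; last first.
  by apply: measurable_funTS; apply/measurable_EFinP; exact: measurable_indic.
by rewrite integral_indic// setIC.
Qed.

Lemma powR_step_fun h p x : (forall k, 0 <= h k) -> p != 0 ->
  step_fun D h x `^ p = step_fun D (fun k => h k `^ p) x.
Proof.
move=> h0 p0; have hp k : 0 <= h k `^ p by exact: powR_ge0.
apply: EFin_inj; rewrite (step_funE _ hp).
have [[k kx]|nx] := pselect (exists k, D k x).
  by rewrite (step_series_in hp kx) /step_fun (step_series_in h0 kx).
have {}nx k : ~ D k x by move=> kx; apply: nx; exists k.
by rewrite step_series_out// /step_fun step_series_out//= powR0.
Qed.

End step_functions.

Lemma nneseries_geometric {R : realType} (a z : R) : 0 <= a -> 0 <= z < 1 ->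
  (\sum_(0 <= k <oo) (a * z ^+ k)%:E = (a / (1 - z))%:E)%E.
Proof.
move=> a0 /andP[z0 z1]; apply/cvg_lim => //.
rewrite (_ : (fun n => _) = EFin \o series (geometric a z)); last first.
  by apply/funext => n /=; rewrite sumEFin.
apply: cvg_EFin; first exact: nearW.
by apply: cvg_geometric_series; rewrite ger0_norm.
Qed.

Section extremal_function.
Context {R : realType} {d : measure_display} {X : measurableType d}.
Context {mu : probability X R} {N : nat}.
Context {T : set (set X)} {C : set X -> set (set X)}.
Hypothesis N_gt1 : (1 < N)%N.
Hypothesis tree : homogeneous_tree_with mu N T C.
Implicit Types (I J K A : set X) (x : X) (G : set (set X)).

Let NR_gt1 : 1 < N%:R :> R. Proof. by rewrite ltr1n. Qed.
Let NR_gt0 : 0 < N%:R :> R. Proof. exact: lt_trans NR_gt1. Qed.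
Let mT J : T J -> measurable J. Proof. exact: (tree_measurable tree). Qed.

Context {s delta : R}.
Hypothesis s01 : 0 <= s <= 1.
Hypothesis delta01 : 0 <= delta <= 1.

Local Notation E := (heavy_set N_gt1 tree s01 delta01).
Local Notation P := (parent_set N_gt1 tree s01 delta01).
Local Notation D := (plateau N_gt1 tree s01 delta01).
Local Notation parents := (parents N_gt1 tree s01 delta01).
Local Notation m := (fun A => fine (mu A)).

Let mE n : measurable (E n). Proof. exact: measurable_heavy_set. Qed.
Let mP n : measurable (P n). Proof. exact: measurable_parent_set. Qed.
Let mD n : measurable (D n). Proof. exact: measurable_plateau. Qed.
Let mfin A : measurable A -> mu A = (m A)%:E.
Proof. by move=> mA; rewrite fineK// fin_num_measure. Qed.
Let m_ge0 A : 0 <= m A. Proof. by rewrite fine_ge0. Qed.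
Let m_le A B : measurable A -> measurable B -> A `<=` B -> m A <= m B.
Proof.
move=> mA mB AB; rewrite -lee_fin -!mfin//.
by apply: le_measure; rewrite ?inE.
Qed.

(** Each generation occupies the fraction delta / N of the preceding one. *)
Lemma mu_heavy_set n : mu (E n) = (s * (delta / N%:R) ^+ n)%:E.
Proof.
elim: n => [|n IH].
  rewrite mulr1; have [_ _] := projT2 (cid (initial_ex N_gt1 tree s01)); exact.
have := @mu_heavy_setS _ _ _ mu N T C N_gt1 tree s delta s01 delta01 setT n
  measurableT.
rewrite !setTI => ->; last by [].
rewrite mu_parent_set IH -!EFinM; congr EFin; rewrite exprS; ring.
Qed.

Let plateau_split I n : measurable I ->
  m (I `&` D n) = m (I `&` E n) - m (I `&` P n).
Proof.
move=> mI; apply/eqP; rewrite eq_sym subr_eq; apply/eqP/EFin_inj.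
rewrite EFinD -!mfin; try by apply: measurableI.
rewrite -[LHS](_ : mu ((I `&` D n) `|` (I `&` P n)) = _); last first.
  by rewrite -setIUr /plateau setUC setDUK// => x; exact: parent_set_sub.
apply: measureU; try by apply: measurableI.
by apply/seteqP; split=> // x [[_ []]] _ + [_].
Qed.

Lemma mu_plateau n : mu (D n) = ((1 - delta) * s * (delta / N%:R) ^+ n)%:E.
Proof.
rewrite mfin// -(setTI (D n)) plateau_split// !setTI mu_parent_set mu_heavy_set /=.
by congr EFin; ring.
Qed.

Context {u : R}.
Hypothesis u0 : 0 < u.

Definition height (k : nat) : R := u * N%:R ^+ k.

Let h0 k : 0 <= height k. Proof. by rewrite mulr_ge0 ?exprn_ge0// ltW. Qed.
Let hS k : height k.+1 = N%:R * height k. Proof. by rewrite /height exprS mulrCA. Qed.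
Let h_mono k : height k <= height k.+1.
Proof. by rewrite hS ler_peMl// ltW. Qed.

(** The mass on I of the function obtained by stopping the construction at
    generation n, where it is the constant u N^n on the whole of the heavy set. *)
Let truncated_mass I n : R :=
  \sum_(0 <= j < n) height j * m (I `&` D j) + height n * m (I `&` E n).

(** Going to the next generation moves mass inside each parent only, hence
    preserves the mass of a set I that contains every parent it meets. *)
Let truncated_mass_step I n : measurable I ->
    (forall J x, parents n J -> J x -> I x -> J `<=` I) ->
  truncated_mass I n.+1 = truncated_mass I n.
Proof.
move=> mI Isat; rewrite /truncated_mass big_nat_recr//= plateau_split//.
have -> : m (I `&` E n.+1) = N%:R^-1 * m (I `&` P n).
  by rewrite (mu_heavy_setS mI Isat) fineM// fin_num_measure//; exact: measurableI.
rewrite hS mulrACA divff ?gt_eqF// mul1r; move: (height n) => h; ring.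
Qed.

Let mass_le I n : measurable I ->
  \sum_(0 <= j < n) m (I `&` D j) + m (I `&` E n) <= m I.
Proof.
move=> mI; elim: n => [|n IH].
  by rewrite big_nil add0r; apply: m_le => //; exact: measurableI.
apply: le_trans IH; rewrite big_nat_recr//= plateau_split//.
have : m (I `&` E n.+1) <= m (I `&` P n).
  apply: m_le; [exact: measurableI|exact: measurableI|].
  by apply: setIS => x; exact: heavy_setS_sub.
lra.
Qed.

Let truncated_mass_le I n : measurable I -> truncated_mass I n <= height n * m I.
Proof.
move=> mI; apply: le_trans (ler_wpM2l (h0 n) (mass_le n mI)).
rewrite /truncated_mass mulrDr lerD2r mulr_sumr; apply: ler_sum_nat => j /andP[_ jn].
apply: ler_wpM2r => //; rewrite -(subnKC (ltnW jn)).
elim: (n - j)%N => [|k IH]; rewrite ?addn0// addnS.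
exact: le_trans IH (h_mono _).
Qed.

(** Past generation k + 1 the mass of I is preserved: a parent that meets I
    without being contained in it would contain x. In generation k + 1 there are
    two cases. If I contains the parents of generation k that it meets, then its
    mass is that of a function bounded by the height of generation k. Otherwise
    I lies in a parent, but not in its heavy child since it contains x, and it
    loses all the mass beyond generation k. *)
Lemma plateau_partial_sum_le I x k n : T I -> I x -> ~ E k.+1 x -> (k < n)%N ->
  truncated_mass I n <= height k * m I.
Proof.
move=> TI Ix nEx; have mI := mT TI.
have Skn j : truncated_mass I (k.+1 + j) = truncated_mass I k.+1.
  elim: j => [|j IH]; rewrite ?addn0// addnS truncated_mass_step// => J y pJ Jy Iy.
  have TJ := parents_tree pJ.
  have [IJ|//] := tree_nested tree TI TJ Iy Jy.
  exfalso; apply: nEx; apply: (@heavy_set_sub _ _ _ _ _ _ _ _ _ _ _ _ _ k.+1 j).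
  by apply: parent_set_sub; exists J => //; exact: IJ.
move=> kn; rewrite -(subnKC kn) Skn.
have [[J [y [pJ Jy Iy JI]]]|nJ] :=
  pselect (exists J y, [/\ parents k J, J y, I y & ~ J `<=` I]); last first.
  rewrite truncated_mass_step//; first exact: truncated_mass_le.
  by move=> J y pJ Jy Iy; apply: contrapT => JI; apply: nJ; exists J, y.
have TJ := parents_tree pJ.
have IJ : I `<=` J by have [] := tree_nested tree TI TJ Iy Jy.
have IE0 : I `&` E k.+1 = set0.
  apply/seteqP; split=> // z [Iz Ez].
  have : (E k.+1 `&` J) z by split => //; exact: IJ.
  rewrite heavy_set_cap_parents// => cz.
  have [Ic|//] := tree_nested_child TI TJ (ltnW N_gt1) Iz cz.
  apply: nEx; have : (E k.+1 `&` J) x by rewrite heavy_set_cap_parents//; exact: Ic.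
  by case.
rewrite /truncated_mass IE0 measure0 mulr0 addr0.
have := mass_le k.+1 mI; rewrite IE0 measure0 addr0.
move=> /(ler_wpM2l (h0 k)); apply: le_trans.
rewrite mulr_sumr; apply: ler_sum_nat => j /andP[_]; rewrite ltnS => jk.
apply: ler_wpM2r => //; rewrite -(subnKC jk).
elim: (k - j)%N => [|i IH]; rewrite ?addn0// addnS.
exact: le_trans IH (h_mono _).
Qed.

Definition extremal : X -> R := step_fun D height.

Lemma extremal_ge0 x : 0 <= extremal x. Proof. exact: step_fun_ge0. Qed.

Lemma measurable_extremal : measurable_fun setT extremal.
Proof. by apply: measurable_step_fun => //; exact: trivIset_plateau. Qed.

(** The integral over a tree element that contains x is a limit of partial sums,
    which [plateau_partial_sum_le] bounds. *)
Lemma maximal_op_extremal_le x k : ~ E k.+1 x ->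
  (maximal_op mu T extremal x <= (height k)%:E)%E.
Proof.
move=> nEx; apply: ge_ereal_sup => _ [I /= [TI Ix] <-].
have mI := mT TI.
have muI : 0 < m I by exact: (tree_mu_fine N_gt1 tree TI).
rewrite lee_pdivrMl// -EFinM.
under eq_integral do rewrite ger0_norm ?extremal_ge0//.
rewrite integral_step_fun//; last exact: trivIset_plateau.
apply: lime_le.
  by apply: is_cvg_nneseries => j _ _; rewrite mule_ge0// lee_fin.
near=> n; have kn : (k < n)%N by near: n; exact: nbhs_infty_gt.
rewrite mulrC; have := plateau_partial_sum_le TI Ix nEx kn; rewrite -lee_fin.
apply: le_trans; rewrite /truncated_mass EFinD -[leLHS]adde0; apply: leeD; last first.
  by rewrite lee_fin mulr_ge0.
rewrite -sumEFin le_eqVlt; apply/orP; left; apply/eqP.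
apply: eq_bigr => j _.
by have mID := mfin (measurableI _ _ mI (mD j)); rewrite [RHS]EFinM -mID.
Unshelve. all: by end_near. Qed.

Lemma height_powR p k : height k `^ p = u `^ p * (N%:R `^ p) ^+ k.
Proof.
rewrite /height powRM ?exprn_ge0 ?(ltW u0) ?(ltW NR_gt0)//; congr (_ * _).
rewrite -(powR_mulrn k (ltW NR_gt0)) -(powR_mulrn k (powR_ge0 N%:R p)).
by rewrite -2!powRrM [k%:R * p]mulrC.
Qed.

Lemma integral_extremal : delta < 1 -> (\int[mu]_x (extremal x)%:E = (u * s)%:E)%E.
Proof.
move=> d1; have /andP[s0 _] := s01; have /andP[d0 _] := delta01.
rewrite integral_step_fun//; last exact: trivIset_plateau.
under eq_eseriesr => k _.
  rewrite setTI (_ : _ * _ = ((u * s * (1 - delta)) * delta ^+ k)%:E)%E; last first.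
    rewrite [X in (_ * X)%E]mu_plateau -EFinM /height expr_div_n; congr EFin.
    field; rewrite expf_neq0// gt_eqF//.
  over.
rewrite nneseries_geometric ?d0//; last by rewrite !mulr_ge0 ?subr_ge0// ltW.
by congr EFin; field; lra.
Qed.

Context {p : R}.
Hypothesis p1 : 1 < p.
Hypothesis ratio_lt1 : N%:R `^ (p - 1) * delta < 1.

Let Np : N%:R `^ p = N%:R * N%:R `^ (p - 1) :> R.
Proof. by rewrite mulr_powRB1 ?(ltW NR_gt0) ?(lt_trans ltr01 p1). Qed.

Let ratioE : N%:R `^ p * (delta / N%:R) = N%:R `^ (p - 1) * delta.
Proof. by rewrite Np; field; rewrite gt_eqF. Qed.

Let ratio_ge0 : 0 <= N%:R `^ (p - 1) * delta.
Proof. by have /andP[d0 _] := delta01; rewrite mulr_ge0// powR_ge0. Qed.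

Lemma delta_lt1 : delta < 1.
Proof.
have /andP[d0 _] := delta01; apply: le_lt_trans ratio_lt1.
rewrite ler_peMl// -[leLHS](powRr0 N%:R) ler_powR ?subr_ge0 ?(ltW p1)//.
exact: ltW.
Qed.

Lemma integral_extremal_powR : (\int[mu]_x (extremal x `^ p)%:E =
  (u `^ p * s * (1 - delta) / (1 - N%:R `^ (p - 1) * delta))%:E)%E.
Proof.
have /andP[s0 _] := s01; have /andP[d0 d1] := delta01.
have pE x : extremal x `^ p = step_fun D (fun k => height k `^ p) x.
  apply: powR_step_fun; rewrite ?gt_eqF ?(lt_trans ltr01 p1)//.
  exact: trivIset_plateau.
under eq_integral do rewrite pE.
rewrite integral_step_fun//; first last.
- by move=> k; exact: powR_ge0.
- exact: trivIset_plateau.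
under eq_eseriesr => k _.
  rewrite setTI (_ : _ * _ = ((u `^ p * s * (1 - delta)) *
      (N%:R `^ (p - 1) * delta) ^+ k)%:E)%E; last first.
    rewrite [X in (_ * X)%E]mu_plateau -EFinM height_powR -ratioE !exprMn; congr EFin.
    ring.
  over.
rewrite nneseries_geometric ?ratio_ge0//.
by rewrite mulr_ge0 ?subr_ge0// mulr_ge0 ?powR_ge0.
Qed.

(** Let k be the generation at which x leaves the construction. Then M^p is at
    most (u N^k)^p at x, and this telescopes into u^p plus the increments of the
    heights over the generations that contain x. Integrate the increments over
    the whole space, where the generations have explicit measures. *)
Lemma integral_maximal_op_extremal_le A kappa : measurable A -> mu A = kappa%:E ->
  (\int[mu]_(x in A) (maximal_op mu T extremal x `^ p) <=
   (kappa * u `^ p + u `^ p * s * (N%:R `^ p - 1) * (delta / N%:R) /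
     (1 - N%:R `^ (p - 1) * delta))%:E)%E.
Proof.
move=> mA muA; have /andP[s0 _] := s01; have /andP[d0 d1] := delta01.
have p0 : 0 < p by exact: lt_trans p1.
have intE := integral_extremal delta_lt1.
have M_ge x := maximal_op_ge_mean tree measurable_extremal extremal_ge0 intE x.
pose c k : R := height k.+1 `^ p - height k `^ p.
have cE k : c k = u `^ p * (N%:R `^ p - 1) * (N%:R `^ p) ^+ k.
  by rewrite /c !height_powR exprS; ring.
have Np1 : 1 < N%:R `^ p :> R by exact: (lt_trans NR_gt1 (powR_gt_base p1 NR_gt1)).
have c0 k : 0 <= c k.
  by rewrite cE mulr_ge0 ?exprn_ge0 ?powR_ge0// mulr_ge0 ?powR_ge0// subr_ge0 ltW.
pose B x := ((u `^ p)%:E + \sum_(0 <= k <oo) (c k * \1_(E k.+1) x)%:E)%E.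
have m1 k : measurable_fun setT (fun x => (c k * \1_(E k.+1) x)%:E).
  apply/measurable_EFinP; apply: measurable_funM; first exact: measurable_cst.
  by apply: measurable_indic; exact: mE.
have mSum : measurable_fun setT (fun x =>
    \sum_(0 <= k <oo) (c k * \1_(E k.+1) x)%:E)%E.
  have := @ge0_emeasurable_sum _ _ R setT (fun k x => (c k * \1_(E k.+1) x)%:E) predT.
  by apply => //; move=> k x _ _; rewrite lee_fin mulr_ge0.
have cx0 k x : (0 <= (c k * \1_(E k.+1) x)%:E)%E by rewrite lee_fin mulr_ge0.
have B_ge k x : (forall j, (j < k)%N -> E j.+1 x) -> ((height k `^ p)%:E <= B x)%E.
  move=> Ex; apply: (@le_trans _ _ ((u `^ p)%:E +
      \sum_(0 <= j < k) (c j * \1_(E j.+1) x)%:E)%E); last first.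
    by rewrite leeD2l//; apply: nneseries_lim_ge.
  rewrite (eq_big_nat _ _ (F2 := fun j => (c j)%:E)) => [|j /andP[_ jk]]; last first.
    by rewrite indicE mem_set ?mulr1//; exact: Ex.
  rewrite sumEFin -EFinD lee_fin /c telescope_sumr//.
  by rewrite {3}/height expr0 mulr1 addrC subrK.
have MB x : (maximal_op mu T extremal x `^ p <= B x)%E.
  have [[k0 nEk0]|Eall] := pselect (exists k, ~ E k.+1 x).
    have ex : exists k, `[< ~ E k.+1 x >] by exists k0; exact/asboolP.
    case: (ex_minnP ex) => k /asboolP nEk kmin.
    apply: (@le_trans _ _ ((height k `^ p)%:E)); last first.
      apply: B_ge => j jk; apply: contrapT => nj.
      by have := kmin j (asboolT nj); rewrite leqNgt jk.
    rewrite -poweR_EFin; apply: gt0_ler_poweR; first exact: ltW.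
    - rewrite in_itv/= leey andbT; apply: le_trans (M_ge x).
      by rewrite lee_fin mulr_ge0// ltW.
    - by rewrite in_itv/= leey andbT lee_fin.
    - exact: maximal_op_extremal_le.
  have {}Eall k : E k.+1 x by apply: contrapT => nE; apply: Eall; exists k.
  suff -> : B x = +oo%E by exact: leey.
  (* The bounds (u N^k)^p, for all k, are below [B x]. *)
  apply/eqyP => r r0.
  apply: le_trans (B_ge (Num.truncn (r / u `^ p)).+1 x _); last first.
    by move=> j _; exact: Eall.
  rewrite lee_fin height_powR mulrC -ler_pdivrMr ?powR_gt0//.
  apply: (le_trans (ltW (truncnS_gt _))); set k := (Num.truncn _).+1.
  apply: (@le_trans _ _ (N%:R ^+ k)).
    by rewrite -natrX ler_nat ltnW// ltn_expl.
  by rewrite lerXn2r ?nnegrE ?powR_ge0 ?(ltW NR_gt0)// ltW// powR_gt_base.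
apply: (@le_trans _ _ (\int[mu]_(x in A) B x)%E).
  apply: ge0_le_integral => //.
  - by move=> x _; exact: poweR_ge0.
  - apply: measurable_funTS.
    apply: measurable_fun_poweR.
    exact: (measurable_maximal_op tree measurable_extremal extremal_ge0 intE).
  - by apply: measurable_funTS; apply: emeasurable_funD.
rewrite ge0_integralD//; first last.
- exact: measurable_funTS.
- by move=> x _; apply: nneseries_ge0 => k _ _; exact: cx0.
- by move=> x _; rewrite lee_fin powR_ge0.
rewrite integral_cst//.
rewrite integral_nneseries//; last by move=> k; exact: measurable_funTS.
rewrite EFinD; apply: leeD; first by rewrite mulrC EFinM -muA.
rewrite -(@nneseries_geometric R _ (N%:R `^ (p - 1) * delta)) ?ratio_ge0//;
  last first.
  rewrite mulr_ge0 ?divr_ge0 ?(ltW NR_gt0)// mulr_ge0 ?subr_ge0 ?(ltW Np1)//.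
  by rewrite mulr_ge0 ?powR_ge0.
apply: lee_nneseries => [k _ _|k _].
  by apply: integral_ge0 => x _; exact: cx0.
under eq_integral do rewrite EFinM.
rewrite ge0_integralZl_EFin//; last first.
  by apply: measurable_funTS; apply/measurable_EFinP; exact: measurable_indic.
rewrite integral_indic//.
apply: (@le_trans _ _ ((c k)%:E * mu (E k.+1))%E).
  rewrite lee_wpmul2l ?lee_fin//; apply: le_measure; rewrite ?inE//.
  exact: measurableI.
rewrite mu_heavy_set -EFinM lee_fin cE -ratioE exprS !exprMn.
rewrite le_eqVlt; apply/orP; left; apply/eqP; ring.
Qed.

End extremal_function.

(** * The value of the Bellman function *)

Section bellman_value.
Context {R : realType} {d : measure_display} {X : measurableType d}.
Context {mu : probability X R} {N : nat} {T : set (set X)}.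
Context {p F f kappa : R}.
Hypothesis N_gt1 : (1 < N)%N.
Hypothesis tree : homogeneous_tree mu N T.
Hypothesis p_gt1 : 1 < p.
Hypothesis F_gt0 : 0 < F.
Hypothesis f_gt0 : 0 < f.
Hypothesis fp_leF : f `^ p <= F.
Hypothesis kappa_gt0 : 0 < kappa.
Hypothesis kappa_le1 : kappa <= 1.

Local Notation U := ((F / f) `^ (p - 1)^-1).
Local Notation h := (bellman_candidate N p F f kappa).
Local Notation D := (lower_bellman mu T p F f kappa).

Let pm0 : 0 < p - 1. Proof. by rewrite subr_gt0. Qed.
Let p_gt0 : 0 < p. Proof. exact: lt_trans p_gt1. Qed.
Let U_gt0 : 0 < U. Proof. by rewrite powR_gt0// divr_gt0. Qed.
Let U_powR : U `^ (p - 1) = F / f.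
Proof. by rewrite powR_invK// ltW// divr_gt0. Qed.

(** The extremal function with s = f / u has the integral f. The fraction delta
    is found by solving F = u^(p-1) f (1 - delta) / (1 - N^(p-1) delta); since
    u^(p-1) f <= F, the solution is nonnegative and makes the geometric series
    converge. *)
Lemma lower_bellman_le u : f <= u <= U -> (D <= (h u)%:E)%E.
Proof.
move=> /andP[fu uU]; have [C treeC] := tree.
have u_gt0 : 0 < u by exact: lt_le_trans fu.
have NR_gt1 : 1 < N%:R :> R by rewrite ltr1n.
have NR_gt0 : 0 < N%:R :> R by exact: lt_trans NR_gt1.
set q := u `^ (p - 1); have q_gt0 : 0 < q by exact: powR_gt0.
have qf_le : q * f <= F.
  rewrite -ler_pdivlMr// -U_powR ge0_ler_powR ?nnegrE//; exact: ltW.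
have uq : u `^ p = u * q by rewrite mulr_powRB1 ?(ltW u_gt0).
set nu := N%:R `^ (p - 1) : R.
have nu_gt1 : 1 < nu by exact: powR_gt1.
have Nnu : N%:R `^ p = N%:R * nu by rewrite mulr_powRB1 ?(ltW NR_gt0).
pose A := F / (q * f).
have qf_gt0 : 0 < q * f by rewrite mulr_gt0.
have A_ge1 : 1 <= A by rewrite ler_pdivlMr// mul1r.
have FE : F = A * (q * f) by rewrite divfK// gt_eqF.
have den_gt0 : 0 < nu * A - 1 by nra.
pose delta := (A - 1) / (nu * A - 1).
have nud_lt1 : nu * delta < 1.
  by rewrite /delta mulrA ltr_pdivrMr//; nra.
have num_gt0 : 0 < nu * A - 1 - nu * (A - 1) by lra.
have Nnu_gt0 : 0 < N%:R * nu - N%:R by nra.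
have d_ge0 : 0 <= delta by apply: divr_ge0; [rewrite subr_ge0|exact: ltW].
have d_le1 : delta <= 1 by nra.
have s01 : 0 <= f / u <= 1.
  by rewrite divr_ge0 ?(ltW f_gt0) ?(ltW u_gt0)//= ler_pdivrMr// mul1r.
have d01 : 0 <= delta <= 1 by rewrite d_ge0.
pose phi := extremal N_gt1 treeC s01 d01 (u := u).
have d_lt1 : delta < 1 by nra.
apply: ge_ereal_inf; eexists.
  exists phi; last reflexivity; split.
  - exact: measurable_extremal.
  - exact: extremal_ge0.
  - rewrite integral_extremal//; congr EFin; field; lra.
  - rewrite integral_extremal_powR//; congr EFin.
    rewrite uq -/nu FE /delta; field.
    by rewrite !gt_eqF.
apply: ge_ereal_sup => _ [E [mE muE] <-].
apply: (le_trans (integral_maximal_op_extremal_le _ _ _ _ _ _ _ mE muE)) => //.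
rewrite lee_fin /bellman_candidate le_eqVlt; apply/orP; left; apply/eqP.
congr (_ + _); rewrite /homogeneous_ratio uq Nnu -/nu -/q [in RHS]FE /delta; field.
by rewrite !gt_eqF.
Qed.

Lemma lower_bellman_eq v : f <= v <= Num.min U (f / kappa) ->
    (forall u, f <= u <= Num.min U (f / kappa) -> h v <= h u) ->
  D = (h v)%:E.
Proof.
move=> vr vmin; have [C treeC] := tree.
apply/eqP; rewrite eq_le; apply/andP; split.
  apply: lower_bellman_le; move: vr; rewrite le_min => /andP[-> /andP[-> _]].
  by [].
apply: le_ereal_inf_tmp => _ [phi [mphi phi0 intphi intphip] <-].
have [u [ur hu]] := exists_bellman_candidate_le N_gt1 treeC mphi phi0 intphi
  f_gt0 p_gt1 kappa_gt0 kappa_le1 fp_leF intphip.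
by apply: le_trans hu; rewrite lee_fin vmin.
Qed.

End bellman_value.

Theorem theorem1 (R : realType) (d : measure_display) (X : measurableType d)
    (mu : probability X R) (N : nat) (T : set (set X)) (p F f kappa : R)
    (N_gt1 : (1 < N)%N)
    (mu_nonatomic : nonatomic mu)
    (T_tree : homogeneous_tree mu N T)
    (p_gt1 : 1 < p) (F_gt0 : 0 < F) (f_gt0 : 0 < f) (fp_leF : f `^ p <= F)
    (kappa_gt0 : 0 < kappa) (kappa_le1 : kappa <= 1) :
  let a := homogeneous_ratio N p in
  let c := critical_kappa N p in
  let D := lower_bellman mu T p F f kappa in
  [/\ is_minimum
        [set (kappa * u `^ p + a * (F - u `^ (p - 1) * f))%:E
        | u in [set u : R | f <= u <= Num.min ((F / f) `^ (p - 1)^-1)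
                                              (f / kappa)]]
        D,
      c < 1,
      c <= kappa ->
        D = (kappa * f `^ p + a * (F - f `^ p))%:E,
      c * (f `^ p / F) `^ (p - 1)^-1 <= kappa <= c ->
        D = (a * (F - c `^ (p - 1) * (f `^ p / (p * kappa `^ (p - 1)))))%:E &
      kappa <= c * (f `^ p / F) `^ (p - 1)^-1 ->
        D = (kappa * (F / f) `^ (p / (p - 1)))%:E].
Proof.
move=> a c D.
have pm0 : 0 < p - 1 by rewrite subr_gt0.
have p_gt0 : 0 < p by exact: lt_trans p_gt1.
have c_gt0 : 0 < c by exact: critical_kappa_gt0.
have c_lt1 : c < 1 by exact: critical_kappa_lt1.
set U := (F / f) `^ (p - 1)^-1; set G := (f `^ p / F) `^ (p - 1)^-1.
have U_gt0 : 0 < U by rewrite powR_gt0// divr_gt0.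
(* This identity turns the comparison of kappa with c G into that of the
   critical point w = c f / kappa with the bound U. *)
have UG : U * G = f.
  rewrite /U /G -powRM ?divr_ge0 ?powR_ge0 ?(ltW F_gt0) ?(ltW f_gt0)//.
  have -> : F / f * (f `^ p / F) = f `^ (p - 1).
    rewrite -(@mulr_powRB1 R f p) ?(ltW f_gt0)//; field; lra.
  by rewrite -powRrM divff ?gt_eqF// powRr1// ltW.
have U_powR : U `^ (p - 1) = F / f.
  by rewrite powR_invK// ltW// divr_gt0.
have fU : f <= U.
  apply: le_powR_inv => //; [exact: ltW|by rewrite ltW// divr_gt0|].
  by rewrite ler_pdivlMr// mulrC mulr_powRB1 ?(ltW f_gt0).
pose h := bellman_candidate N p F f kappa.
pose w := c * f / kappa.
have w_gt0 : 0 < w by rewrite divr_gt0// mulr_gt0.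
have w_lt : w < f / kappa by rewrite ltr_pM2r ?invr_gt0// gtr_pMl.
have f_lek : f <= f / kappa by rewrite ler_pdivlMr// ger_pMr.
have range u : f <= u <= Num.min U (f / kappa) =
    [&& f <= u, u <= U & u <= f / kappa].
  by rewrite le_min.
have DE v : f <= v -> v <= U -> v <= f / kappa ->
    (forall u, f <= u <= U -> 0 <= (v - w) * (u - v)) -> D = (h v)%:E.
  move=> fv vU vk vw.
  apply: lower_bellman_eq => //; first by rewrite range fv vU.
  move=> u; rewrite range => /and3P[fu uU uk].
  apply: bellman_candidate_unimodal => //.
  - by rewrite (le_trans (ltW f_gt0)).
  - by rewrite (le_trans (ltW f_gt0)).
  - by apply: vw; rewrite fu.
have D1 : c <= kappa -> D = (h f)%:E.
  move=> ck; apply: DE => // u /andP[fu uU]; rewrite mulr_ge0 ?subr_ge0//.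
  by rewrite ler_pdivrMr// mulrC ler_pM2l.
have wU : (w <= U) = (c * G <= kappa).
  by rewrite /w ler_pdivrMr// -{1}UG mulrCA ler_pM2l.
have D2 : c * G <= kappa <= c -> D = (h w)%:E.
  move=> /andP[cGk kc]; apply: DE.
  - by rewrite /w ler_pdivlMr// mulrC ler_pM2r.
  - by rewrite wU.
  - exact: ltW.
  - by move=> u _; rewrite subrr mul0r.
have D3 : kappa <= c * G -> D = (h U)%:E.
  move=> kcG.
  have Uw : U <= w.
    by rewrite /w ler_pdivlMr// -UG mulrCA ler_pM2l.
  apply: DE => //; first exact: le_trans Uw (ltW w_lt).
  by move=> u /andP[fu uU]; rewrite mulr_le0// subr_le0.
have hf : h f = kappa * f `^ p + a * (F - f `^ p).
  by rewrite /h /bellman_candidate [f `^ (p - 1) * f]mulrC mulr_powRB1 ?(ltW f_gt0).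
have hw : h w = a * (F - c `^ (p - 1) * (f `^ p / (p * kappa `^ (p - 1)))).
  have wk : w `^ (p - 1) * kappa `^ (p - 1) = c `^ (p - 1) * f `^ (p - 1).
    rewrite -!powRM ?(ltW w_gt0) ?(ltW kappa_gt0) ?(ltW c_gt0) ?(ltW f_gt0)//.
    by rewrite divfK// gt_eqF.
  have kq : 0 < kappa `^ (p - 1) by exact: powR_gt0.
  rewrite /h /bellman_candidate -/a.
  rewrite -(@mulr_powRB1 R w p) ?(ltW w_gt0)// -(@mulr_powRB1 R f p) ?(ltW f_gt0)//.
  have -> : w `^ (p - 1) = c `^ (p - 1) * f `^ (p - 1) / kappa `^ (p - 1).
    by rewrite -wk mulfK// gt_eqF.
  rewrite /w [c in c * f](_ : c = (p - 1) / p * a)//.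
  move: (c `^ (p - 1)) (f `^ (p - 1)) (kappa `^ (p - 1)) kq => x y z z0.
  by field; lra.
have hU : h U = kappa * (F / f) `^ (p / (p - 1)).
  rewrite /h /bellman_candidate U_powR divfK ?gt_eqF// subrr mulr0 addr0.
  by rewrite /U -powRrM [_^-1 * p]mulrC.
split => //.
- suff [v [fv vU vk Dv]] : exists v,
      [/\ f <= v, v <= U, v <= f / kappa & D = (h v)%:E].
    split; first by exists v => //=; rewrite range fv vU.
    move=> _ [u /= ur <-]; apply: lower_bellman_le => //.
    by move: ur; rewrite range => /and3P[-> ->].
  have [ck|kc] := leP c kappa; first by exists f; rewrite D1.
  have [cGk|kcG] := leP (c * G) kappa.
    exists w; rewrite D2 ?cGk ?(ltW kc) ?wU// (ltW w_lt); split => //.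
    by rewrite /w ler_pdivlMr// mulrC ler_pM2r// ltW.
  exists U; rewrite D3 ?(ltW kcG)// fU lexx; split => //.
  apply: le_trans (ltW w_lt).
  by rewrite /w ler_pdivlMr// -UG mulrCA ler_pM2l// ltW.
- by move/D1 => ->; rewrite hf.
- by move/D2 => ->; rewrite hw.
- by move/D3 => ->; rewrite hU.
Qed.
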